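(* (i) For any $l\ge1$, the element $Y_{\mathbb{N}^{l+2}\rightarrow\mathbb{N}}\in{\mathsf{SF}}$ is not denotable in ${\mathrm{PCF}}^\Omega_{1,l}$. (ii) The element $Y_{\overline2}\in{\mathsf{SF}}$ is not denotable in ${\mathrm{PCF}}^\Omega_1$.
   Context: Types $\sigma::=\mathbb{N}\mid\sigma\rightarrow\sigma$; $\mathbb{N}^{m}\rightarrow\mathbb{N}$ denotes $\mathbb{N}\rightarrow\cdots\rightarrow\mathbb{N}\rightarrow\mathbb{N}$ with $m$ arguments; level ${\mathrm{lv}}(\mathbb{N})=0$, ${\mathrm{lv}}(\sigma\rightarrow\tau)=\max({\mathrm{lv}}\,\sigma+1,{\mathrm{lv}}\,\tau)$; $\overline2=(\mathbb{N}\rightarrow\mathbb{N})\rightarrow\mathbb{N}$. Width: $w(\mathbb{N})=0$, $w(\sigma_0,\ldots,\sigma_{r-1}\rightarrow\mathbb{N})=\max(r,w(\sigma_0),\ldots,w(\sigma_{r-1}))$. For $k,l\ge1$, sublevel $(k,l)$ means level $k$ and width $l$; $\mathbb{N}$ has sublevel $0$ (lowest); $(k,l)<(k',l')$ iff $k<k'$ or ($k=k'$ and $l<l'$). ${\mathrm{PCF}}^\Omega$: simply typed $\lambda$-calculus over $\mathbb{N}$ with constants $\underline n,\mathit{suc},\mathit{pre},\mathit{ifzero}$, $Y_\sigma:(\sigma\rightarrow\sigma)\rightarrow\sigma$ for all $\sigma$ and $C_f:\mathbb{N}\rightarrow\mathbb{N}$ for each partial $f:\mathbb{N}\rightharpoonup\mathbb{N}$,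 with call-by-name operational semantics. ${\mathrm{PCF}}^\Omega_{1,l}$ admits $Y_\sigma$ only for $\sigma$ of sublevel $\le(1,l)$, i.e. $\sigma=\mathbb{N}$ or $\sigma=\mathbb{N}^m\rightarrow\mathbb{N}$ with $m\le l$; ${\mathrm{PCF}}^\Omega_1$ admits $Y_\sigma$ only for ${\mathrm{lv}}(\sigma)\le1$. ${\mathsf{SF}}(\sigma)$: closed ${\mathrm{PCF}}^\Omega$ terms of type $\sigma$ modulo observational equivalence ($M\simeq M'$ iff for all closed contexts $C[-]:\mathbb{N}$ and $n$, $C[M]$ reduces to $\underline n$ iff $C[M']$ does), with application induced by term application. An element is denotable in a sublanguage if it is the class of one of its closed terms. *)

(* Defs.v *)
From Stdlib Require Import Arith List Relations.
Import ListNotations.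

Inductive ty : Type :=
| TN : ty
| TArr : ty -> ty -> ty.

Fixpoint narr (m : nat) : ty :=
  match m with
  | 0 => TN
  | S m' => TArr TN (narr m')
  end.

Fixpoint lv (s : ty) : nat :=
  match s with
  | TN => 0
  | TArr a b => Nat.max (S (lv a)) (lv b)
  end.

(* width: w(s_0,...,s_{r-1} -> N) = max(r, w s_0, ..., w s_{r-1}) *)
Fixpoint arity (s : ty) : nat :=
  match s with TN => 0 | TArr _ b => S (arity b) end.
Fixpoint argwidth (s : ty) : nat :=
  match s with TN => 0 | TArr a b => Nat.max (width a) (argwidth b) end
with width (s : ty) : nat :=
  match s with TN => 0 | TArr a b => Nat.max (arity s) (Nat.max (width a) (argwidth b)) end.

Definition bar2 : ty := TArr (TArr TN TN) TN.

Inductive tm : Type :=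
| Var : nat -> tm
| Lam : ty -> tm -> tm
| App : tm -> tm -> tm
| Num : nat -> tm
| Suc : tm
| Pre : tm
| Ifz : tm
| Yc  : ty -> tm
| Cf  : (nat -> option nat) -> tm.

Inductive has_type : list ty -> tm -> ty -> Prop :=
| T_Var : forall G n s, nth_error G n = Some s -> has_type G (Var n) s
| T_Lam : forall G s t M, has_type (s :: G) M t -> has_type G (Lam s M) (TArr s t)
| T_App : forall G s t M N, has_type G M (TArr s t) -> has_type G N s ->
    has_type G (App M N) t
| T_Num : forall G n, has_type G (Num n) TN
| T_Suc : forall G, has_type G Suc (TArr TN TN)
| T_Pre : forall G, has_type G Pre (TArr TN TN)
| T_Ifz : forall G, has_type G Ifz (TArr TN (TArr TN (TArr TN TN)))
| T_Y : forall G s, has_type G (Yc s) (TArr (TArr s s) s)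
| T_Cf : forall G f, has_type G (Cf f) (TArr TN TN).

Fixpoint lift (d c : nat) (t : tm) : tm :=
  match t with
  | Var n => if c <=? n then Var (n + d) else Var n
  | Lam s M => Lam s (lift d (S c) M)
  | App M N => App (lift d c M) (lift d c N)
  | _ => t
  end.

Fixpoint subst (j : nat) (u : tm) (t : tm) : tm :=
  match t with
  | Var n => if n =? j then u else if j <? n then Var (pred n) else Var n
  | Lam s M => Lam s (subst (S j) (lift 1 0 u) M)
  | App M N => App (subst j u M) (subst j u N)
  | _ => t
  end.

Definition is_fo_const (c : tm) : Prop :=
  c = Suc \/ c = Pre \/ c = Ifz \/ exists f, c = Cf f.

Inductive step : tm -> tm -> Prop :=
| S_Beta : forall s M N, step (App (Lam s M) N) (subst 0 N M)
| S_Y : forall s M, step (App (Yc s) M) (App M (App (Yc s) M))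
| S_Suc : forall n, step (App Suc (Num n)) (Num (S n))
| S_Pre : forall n, step (App Pre (Num n)) (Num (pred n))
| S_Ifz0 : forall a b, step (App (App (App Ifz (Num 0)) a) b) a
| S_IfzS : forall n a b, step (App (App (App Ifz (Num (S n))) a) b) b
| S_Cf : forall f n m, f n = Some m -> step (App (Cf f) (Num n)) (Num m)
| S_AppL : forall M M' N, step M M' -> step (App M N) (App M' N)
| S_Arg : forall c N N', is_fo_const c -> step N N' -> step (App c N) (App c N').

Definition reduces_to (M : tm) (n : nat) : Prop :=
  clos_refl_trans tm step M (Num n).

(* A closed context C[-] : N with a hole of type s is represented as a term
   C with has_type [s] C TN; since only closed terms are plugged in,
   C[M] is subst 0 M C. *)
Definition obs_eq (s : ty) (M M' : tm) : Prop :=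
  forall C, has_type [s] C TN ->
    forall n, reduces_to (subst 0 M C) n <-> reduces_to (subst 0 M' C) n.

Fixpoint Y_only (P : ty -> Prop) (t : tm) : Prop :=
  match t with
  | Lam _ M => Y_only P M
  | App M N => Y_only P M /\ Y_only P N
  | Yc s => P s
  | _ => True
  end.

(* Y_sigma admissible in PCF^Omega_{1,l}: sublevel of sigma <= (1,l) *)
Definition adm_1l (l : nat) (s : ty) : Prop :=
  lv s = 0 \/ (lv s = 1 /\ width s <= l).

Definition adm_1 (s : ty) : Prop := lv s <= 1.

(* the class of the closed term M of type s in SF(s) is denotable in the
   sublanguage whose admissible Y-types are given by P *)
Definition denotable (P : ty -> Prop) (s : ty) (M : tm) : Prop :=
  exists M', has_type [] M' s /\ Y_only P M' /\ obs_eq s M' M.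

(* Main.v *)
From Stdlib Require Import Arith List Relations Lia Classical IndefiniteDescription.
Require Import Defs.
Import ListNotations.

(** Write [rho] for the type of functions of [l + 2] numbers. The functional [test l k w]
    of type [rho -> rho] reads its first number as a level [j <= k], its other [l + 1]
    arguments as lazy inputs. At each level one secret input position carries a secret key
    and all other inputs diverge. A call at level [j] checks the key of level [j]; if
    [j > 0] it also calls its functional argument at level [j - 1] with the inputs of that
    level and checks that the result is a secret answer; then it returns that answer.
    Iterating it from level [k] downwards yields the answer, for all secrets [w].

    A program that does so must nest calls of the functional, handing the inputs of each
    level to the next call without knowing which of them may be evaluated. A recursive
    function of at most [l] lazy numbers loses one of the [l + 1] positions. So the nesting
    has to be achieved by the syntactic nesting of binders, which is bounded, while [k] is
    not. A Kripke logical relation on families of terms indexed by [k] and the secrets makes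
    this precise without normalizing terms: a stage records about which positions at which
    levels the terms in scope may be informed, and a gap of uninformed levels whose size
    tends to infinity with [k] replaces the bound on the syntactic depth.

    The second part follows since [rho] is a retract of [bar2] and a given term contains
    fixed point operators of bounded arity only. *)

(** * Closed terms and parallel substitution *)

Fixpoint closed_at (n : nat) (t : tm) : Prop :=
  match t with
  | Var m => m < n
  | Lam _ M => closed_at (S n) M
  | App M N => closed_at n M /\ closed_at n N
  | _ => True
  end.

Notation closed := (closed_at 0).

Lemma closed_at_weaken (t : tm) : forall m n, m <= n -> closed_at m t -> closed_at n t.
Proof.
  induction t; simpl; intros m n' Hmn H; auto; try lia.
  - apply (IHt (S m)); auto; lia.
  - destruct H; split; eauto.
Qed.

Lemma lift_closed_at (t : tm) : forall n d c, closed_at n t -> n <= c -> lift d c t = t.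
Proof.
  induction t; simpl; intros m d c H Hc; auto.
  - destruct (Nat.leb_spec c n); auto; lia.
  - f_equal. apply (IHt (S m)); auto; lia.
  - destruct H; f_equal; eauto.
Qed.

Lemma subst_closed_at (t : tm) : forall n j u, closed_at n t -> n <= j -> subst j u t = t.
Proof.
  induction t; simpl; intros m j u H Hj; auto.
  - destruct (Nat.eqb_spec n j); [lia|]. destruct (Nat.ltb_spec j n); auto; lia.
  - f_equal. apply (IHt (S m)); auto; lia.
  - destruct H; f_equal; eauto.
Qed.

Lemma has_type_closed_at (G : list ty) (t : tm) (s : ty) :
  has_type G t s -> closed_at (length G) t.
Proof.
  induction 1; simpl in *; auto.
  apply nth_error_Some. congruence.
Qed.

Lemma has_type_weaken (G : list ty) (t : tm) (s : ty) :
  has_type G t s -> forall G', has_type (G ++ G') t s.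
Proof.
  induction 1; intros G'; try (econstructor; eauto; fail).
  - constructor. rewrite nth_error_app1; auto. apply nth_error_Some. congruence.
Qed.

Lemma has_type_nil_weaken (t : tm) (s : ty) (G : list ty) :
  has_type [] t s -> has_type G t s.
Proof. intros H. exact (has_type_weaken _ _ _ H G). Qed.

(* The substituted terms are meant to be closed, hence are not lifted under binders. *)
Fixpoint psub (c : nat) (ga : list tm) (t : tm) : tm :=
  match t with
  | Var n => if n <? c then Var n else
      match nth_error ga (n - c) with Some u => u | None => Var (n - length ga) end
  | Lam s M => Lam s (psub (S c) ga M)
  | App M N => App (psub c ga M) (psub c ga N)
  | _ => t
  end.

(** Turns a beta step into one more entry of the environment; closedness of the entries makes the
    shift in [subst] vacuous. *)
Lemma subst_psub (u : tm) (ga : list tm) : closed u -> Forall closed ga ->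
  forall t c, subst c u (psub (S c) ga t) = psub c (u :: ga) t.
Proof.
  intros Hu Hga. induction t; intros c; simpl; auto.
  - destruct (Nat.ltb_spec n (S c)); destruct (Nat.ltb_spec n c); try lia.
    + simpl. destruct (Nat.eqb_spec n c); [lia|]. destruct (Nat.ltb_spec c n); auto; lia.
    + assert (n = c) as -> by lia. simpl. rewrite Nat.eqb_refl, Nat.sub_diag. reflexivity.
    + replace (n - c) with (S (n - S c)) by lia. simpl.
      destruct (nth_error ga (n - S c)) eqn:E.
      * apply (subst_closed_at _ 0); [|lia].
        rewrite Forall_forall in Hga. apply Hga. eapply nth_error_In; eauto.
      * apply nth_error_None in E. simpl.
        destruct (Nat.eqb_spec (n - length ga) c); [lia|].
        destruct (Nat.ltb_spec c (n - length ga)); [|lia]. f_equal. lia.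
  - rewrite (lift_closed_at u 0) by (auto; lia). now rewrite IHt.
  - now rewrite IHt1, IHt2.
Qed.

Lemma psub_closed_at (ga : list tm) (t : tm) : Forall closed ga ->
  forall c, closed_at (c + length ga) t -> closed_at c (psub c ga t).
Proof.
  intros Hga. induction t; simpl; intros c H; auto.
  - destruct (Nat.ltb_spec n c); simpl; auto.
    destruct (nth_error ga (n - c)) eqn:E.
    + apply (closed_at_weaken _ 0); [lia|].
      rewrite Forall_forall in Hga. apply Hga. eapply nth_error_In; eauto.
    + apply nth_error_None in E. lia.
  - destruct H; auto.
Qed.

Lemma psub_id (ga : list tm) (t : tm) : forall n c, closed_at n t -> n <= c -> psub c ga t = t.
Proof.
  induction t; simpl; intros m c H Hc; auto.
  - destruct (Nat.ltb_spec n c); auto; lia.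
  - f_equal. apply (IHt (S m)); auto; lia.
  - destruct H; f_equal; eauto.
Qed.

Fixpoint apps (t : tm) (us : list tm) : tm :=
  match us with
  | [] => t
  | u :: us' => apps (App t u) us'
  end.

Fixpoint lams (n : nat) (t : tm) : tm :=
  match n with
  | 0 => t
  | S n' => Lam TN (lams n' t)
  end.

Lemma psub_apps (c : nat) (ga : list tm) (us : list tm) :
  forall t, psub c ga (apps t us) = apps (psub c ga t) (map (psub c ga) us).
Proof. induction us; simpl; auto. Qed.

Lemma psub_lams (ga : list tm) (n : nat) :
  forall c t, psub c ga (lams n t) = lams n (psub (n + c) ga t).
Proof.
  induction n; simpl; intros c t; auto. rewrite IHn, Nat.add_succ_r. reflexivity.
Qed.

Lemma apps_closed_at (n : nat) (us : list tm) : forall t,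
  closed_at n t -> Forall (closed_at n) us -> closed_at n (apps t us).
Proof.
  induction us; simpl; intros t Ht H; auto.
  inversion H; subst. apply IHus; simpl; auto.
Qed.

Lemma has_type_apps (G : list ty) (us : list tm) : forall t,
  has_type G t (narr (length us)) -> Forall (fun u => has_type G u TN) us ->
  has_type G (apps t us) TN.
Proof.
  induction us; simpl; intros t Ht H; auto.
  inversion H; subst. apply IHus; auto. econstructor; eauto.
Qed.

Lemma has_type_lams (n : nat) : forall G t,
  has_type (repeat TN n ++ G) t TN -> has_type G (lams n t) (narr n).
Proof.
  induction n; simpl; intros G t H; auto.
  constructor. apply IHn.
  replace (repeat TN n ++ TN :: G) with (TN :: repeat TN n ++ G); auto.
  rewrite app_comm_cons.
  replace (TN :: repeat TN n) with (repeat TN n ++ [TN])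
    by (symmetry; apply (repeat_cons n)).
  now rewrite <- app_assoc.
Qed.

(** * Evaluation within a bounded number of steps *)

Lemma Num_step (n : nat) (t : tm) : ~ step (Num n) t.
Proof. intros H; inversion H. Qed.

Lemma fo_const_step (c t : tm) : is_fo_const c -> ~ step c t.
Proof.
  intros [->|[->|[->|[f ->]]]] H; inversion H.
Qed.

Ltac step_absurd :=
  match goal with
  | H : step (Num _) _ |- _ => now inversion H
  | H : step (Lam _ _) _ |- _ => now inversion H
  | H : step Suc _ |- _ => now inversion H
  | H : step Pre _ |- _ => now inversion H
  | H : step Ifz _ |- _ => now inversion H
  | H : step (Cf _) _ |- _ => now inversion H
  | H : step (Yc _) _ |- _ => now inversion H
  | H : is_fo_const _ |- _ =>
      exfalso; destruct H as [H|[H|[H|[? H]]]]; discriminate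
  | H : is_fo_const ?c, H' : step ?c _ |- _ => now apply fo_const_step in H'
  end.

Lemma Ifz_Num_step (n : nat) (a t : tm) : ~ step (App (App Ifz (Num n)) a) t.
Proof.
  intros H. inversion H as [| | | | | | |? ? ? K|]; subst; [|step_absurd].
  inversion K; subst; step_absurd.
Qed.

Lemma step_det (t u : tm) : step t u -> forall u', step t u' -> u = u'.
Proof.
  induction 1; intros u' H'; inversion H'; subst; try reflexivity; try congruence;
    try step_absurd; try (f_equal; auto; fail).
  all: match goal with K : step (App (App Ifz _) _) _ |- _ => now apply Ifz_Num_step in K end.
Qed.

Fixpoint nsteps (n : nat) (t u : tm) : Prop :=
  match n with
  | 0 => t = u
  | S n' => exists t', step t t' /\ nsteps n' t' u
  end.

Lemma nsteps_trans (m n : nat) : forall t u v,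
  nsteps m t u -> nsteps n u v -> nsteps (m + n) t v.
Proof.
  induction m; simpl; intros t u v.
  - now intros ->.
  - intros (t' & H & H') Hn. eauto.
Qed.

Lemma star_nsteps (t u : tm) : clos_refl_trans tm step t u <-> exists n, nsteps n t u.
Proof.
  split.
  - induction 1.
    + exists 1. simpl. eauto.
    + now exists 0.
    + destruct IHclos_refl_trans1 as [m Hm], IHclos_refl_trans2 as [n Hn].
      exists (m + n). eapply nsteps_trans; eauto.
  - intros [n H]. revert t H. induction n; simpl; intros t H.
    + subst. apply rt_refl.
    + destruct H as (t' & H & H'). eapply rt_trans; [apply rt_step; eauto|auto].
Qed.

Lemma nsteps_Num (n m : nat) (u : tm) : nsteps n (Num m) u -> n = 0 /\ u = Num m.
Proof.
  destruct n; simpl; [now intros <-|]. intros (t' & H & _). now apply Num_step in H.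
Qed.

Lemma nsteps_Num_split (n : nat) : forall t u m k,
  nsteps m t (Num k) -> nsteps n t u -> n <= m /\ nsteps (m - n) u (Num k).
Proof.
  induction n; simpl; intros t u m k Hm Hn.
  - subst. split; [lia|]. now rewrite Nat.sub_0_r.
  - destruct Hn as (t' & H & H'). destruct m; simpl in Hm.
    + subst. now apply Num_step in H.
    + destruct Hm as (t'' & K & K'). rewrite (step_det _ _ H _ K) in H'.
      destruct (IHn _ _ _ _ K' H'). split; [lia|]. auto.
Qed.

(** The strict bound leaves [val 0] empty, the base of the induction on unfoldings of [Y]. *)
Definition val (q : nat) (t : tm) (v : nat) : Prop :=
  exists n, n < q /\ nsteps n t (Num v).

Lemma val_det (q q' : nat) (t : tm) (v v' : nat) : val q t v -> val q' t v' -> v = v'.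
Proof.
  intros (n & _ & H) (n' & _ & H').
  destruct (nsteps_Num_split _ _ _ _ _ H H') as [_ K].
  apply nsteps_Num in K. destruct K as [_ K]. congruence.
Qed.

Lemma val_mono (q q' : nat) (t : tm) (v : nat) : q <= q' -> val q t v -> val q' t v.
Proof. intros Hq (n & Hn & H). exists n. split; auto; lia. Qed.

Lemma val_0 (t : tm) (v : nat) : ~ val 0 t v.
Proof. intros (n & H & _). lia. Qed.

Lemma val_Num (q n v : nat) : val q (Num n) v -> v = n.
Proof. intros (m & _ & H). apply nsteps_Num in H. destruct H. congruence. Qed.

Lemma val_Num_intro (q n : nat) : 0 < q -> val q (Num n) n.
Proof. exists 0. now split. Qed.

(** By determinism any reduction is a prefix of the evaluation to a numeral, so passing to a reduct
    costs no steps. *)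
Lemma val_star (q : nat) (t u : tm) (v : nat) :
  clos_refl_trans tm step t u -> val q t v -> val q u v.
Proof.
  intros Hs (n & Hn & H). apply star_nsteps in Hs. destruct Hs as [m Hm].
  destruct (nsteps_Num_split _ _ _ _ _ H Hm). exists (n - m). split; auto; lia.
Qed.

Lemma val_step (q : nat) (t u : tm) (v : nat) :
  step t u -> (val (S q) t v <-> val q u v).
Proof.
  intros Hs. split.
  - intros (n & Hn & H). destruct n; simpl in H.
    + subst. now apply Num_step in Hs.
    + destruct H as (u' & K & K'). rewrite (step_det _ _ Hs _ K).
      exists n. split; auto; lia.
  - intros (n & Hn & H). exists (S n). split; [lia|]. simpl. eauto.
Qed.

Lemma reduces_to_val (t : tm) (v : nat) : reduces_to t v <-> exists q, val q t v.
Proof.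
  unfold reduces_to. rewrite star_nsteps. split.
  - intros [n H]. exists (S n), n. auto.
  - intros (q & n & _ & H). eauto.
Qed.

Notation ifz a b c := (App (App (App Ifz a) b) c).

Lemma val_App_const (c : tm) (q : nat) (t : tm) (v : nat) :
  is_fo_const c -> c <> Ifz -> val q (App c t) v ->
  exists m, val q t m /\ step (App c (Num m)) (Num v).
Proof.
  intros Hc Hi (n & Hn & H). revert q t Hn H. induction n; simpl; intros q t Hn H.
  - discriminate.
  - destruct H as (u & Hs & H).
    inversion Hs; subst; try step_absurd;
      try (apply nsteps_Num in H; destruct H as [_ H]; inversion H; subst;
           eexists; split; [apply val_Num_intro; lia|assumption]).
    apply (IHn (pred q)) in H; [|lia]. destruct H as (m & Hm & K).
    exists m. split; auto. apply (val_mono (S (pred q))); [lia|].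
    eapply val_step; eauto.
Qed.

Lemma val_Suc (q : nat) (t : tm) (v : nat) :
  val q (App Suc t) v -> exists m, val q t m /\ v = S m.
Proof.
  intros H. apply val_App_const in H; [|now left|discriminate].
  destruct H as (m & H & K). exists m. split; auto.
  inversion K; subst; auto; step_absurd.
Qed.

Lemma val_Pre (q : nat) (t : tm) (v : nat) :
  val q (App Pre t) v -> exists m, val q t m /\ v = pred m.
Proof.
  intros H. apply val_App_const in H; [|now right; left|discriminate].
  destruct H as (m & H & K). exists m. split; auto.
  inversion K; subst; auto; step_absurd.
Qed.

Lemma val_Cf (q : nat) (f : nat -> option nat) (t : tm) (v : nat) :
  val q (App (Cf f) t) v -> exists m, val q t m /\ f m = Some v.
Proof.
  intros H. apply val_App_const in H; [|now right; right; right; exists f|discriminate].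
  destruct H as (m & H & K). exists m. split; auto.
  inversion K; subst; auto; step_absurd.
Qed.

Lemma val_ifz (q : nat) (a b c : tm) (v : nat) : val q (ifz a b c) v ->
  exists m, val q a m /\ val q (match m with 0 => b | S _ => c end) v.
Proof.
  intros (n & Hn & H). revert q a Hn H. induction n; simpl; intros q a Hn H.
  - discriminate.
  - destruct H as (u & Hs & H).
    inversion Hs; subst.
    + exists 0. split; [apply val_Num_intro; lia|]. exists n. split; auto; lia.
    + exists (S n0). split; [apply val_Num_intro; lia|]. exists n. split; auto; lia.
    + inversion H3; subst; try step_absurd.
      inversion H4; subst; try step_absurd.
      apply (IHn (pred q)) in H; [|lia]. destruct H as (m & Hm & K).
      exists m. split; [|apply (val_mono (pred q)); auto; lia].
      apply (val_mono (S (pred q))); [lia|]. eapply val_step; eauto.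
    + step_absurd.
Qed.

Lemma star_App_l (t t' u : tm) :
  clos_refl_trans tm step t t' -> clos_refl_trans tm step (App t u) (App t' u).
Proof.
  induction 1.
  - apply rt_step. now constructor.
  - apply rt_refl.
  - eapply rt_trans; eauto.
Qed.

Lemma step_apps (t t' : tm) (us : list tm) : step t t' -> step (apps t us) (apps t' us).
Proof.
  revert t t'. induction us; simpl; intros t t' H; auto. apply IHus. now constructor.
Qed.

Lemma star_apps (t t' : tm) (us : list tm) :
  clos_refl_trans tm step t t' -> clos_refl_trans tm step (apps t us) (apps t' us).
Proof.
  induction 1.
  - apply rt_step. now apply step_apps.
  - apply rt_refl.
  - eapply rt_trans; eauto.
Qed.

Lemma star_App_const (c t t' : tm) : is_fo_const c ->
  clos_refl_trans tm step t t' -> clos_refl_trans tm step (App c t) (App c t').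
Proof.
  intros Hc. induction 1.
  - apply rt_step. now apply S_Arg.
  - apply rt_refl.
  - eapply rt_trans; eauto.
Qed.

Lemma star_Cf (f : nat -> option nat) (t : tm) (n m : nat) :
  reduces_to t n -> f n = Some m -> reduces_to (App (Cf f) t) m.
Proof.
  intros H Hf. eapply rt_trans.
  - apply star_App_const; [now right; right; right; exists f|apply H].
  - apply rt_step. now constructor.
Qed.

Lemma star_Pre (t : tm) (n : nat) : reduces_to t n -> reduces_to (App Pre t) (pred n).
Proof.
  intros H. eapply rt_trans.
  - apply star_App_const; [now right; left|apply H].
  - apply rt_step. constructor.
Qed.

Lemma star_ifz (a b c : tm) (n : nat) : reduces_to a n ->
  clos_refl_trans tm step (ifz a b c) (match n with 0 => b | S _ => c end).
Proof.
  intros H. eapply rt_trans.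
  - do 2 apply star_App_l. apply star_App_const; [now right; right; left|apply H].
  - apply rt_step. destruct n; constructor.
Qed.

Lemma star_beta (s : ty) (ga : list tm) (t u : tm) : closed u -> Forall closed ga ->
  clos_refl_trans tm step (App (Lam s (psub 1 ga t)) u) (psub 0 (u :: ga) t).
Proof.
  intros Hu Hga. rewrite <- subst_psub by auto. apply rt_step. constructor.
Qed.

(** The arguments enter the environment reversed, since the innermost binder, [Var 0], receives the
    last one. *)
Lemma star_apps_lams (us : list tm) (t : tm) : forall ga,
  Forall closed us -> Forall closed ga ->
  clos_refl_trans tm step (apps (psub 0 ga (lams (length us) t)) us)
    (psub 0 (rev us ++ ga) t).
Proof.
  induction us; simpl; intros ga Hus Hga; [apply rt_refl|].
  inversion Hus; subst. eapply rt_trans.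
  - apply star_apps. now apply star_beta.
  - rewrite <- app_assoc. simpl. apply IHus; auto.
Qed.

(** * Families of terms indexed by secrets *)

(** Relatedness is asked for almost all sizes only, so that gaps may be assumed large. *)
Definition eventually (P : nat -> Prop) : Prop := exists s0, forall s, s0 <= s -> P s.

Lemma eventually_and (P Q : nat -> Prop) :
  eventually P -> eventually Q -> eventually (fun s => P s /\ Q s).
Proof.
  intros [a Ha] [b Hb]. exists (Nat.max a b). intros s Hs. split; [apply Ha|apply Hb]; lia.
Qed.

Lemma eventually_impl (P Q : nat -> Prop) :
  (forall s, P s -> Q s) -> eventually P -> eventually Q.
Proof. intros H [a Ha]. exists a. auto. Qed.

Lemma eventually_Forall {A : Type} (P : nat -> A -> Prop) (xs : list A) :
  Forall (fun x => eventually (fun s => P s x)) xs -> eventually (fun s => Forall (P s) xs).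
Proof.
  induction 1.
  - exists 0. auto.
  - generalize (eventually_and _ _ H IHForall). apply eventually_impl.
    intros s []. now constructor.
Qed.

(* A world holds the secrets of a test functional: at level [wlev] the argument in
   position [wpos] carries the key [wbit], at every other level the argument in position
   [wpos'] carries the key [0], and all other arguments diverge; [wans] is the answer. *)
Record world : Type := World
  { wlev : nat; wpos : nat; wpos' : nat; wbit : nat; wans : nat }.

Definition pos (w : world) (j : nat) : nat := if j =? wlev w then wpos w else wpos' w.
Definition key (w : world) (j : nat) : nat := if j =? wlev w then wbit w else 0.

(** The number is the top level of the test functional, the world holds its secrets. *)
Definition fam : Type := nat -> world -> tm.

Definition inst (s : nat) (w : world) (zs : list fam) : list tm := map (fun z : fam => z s w) zs.

Section Relation.

Context (l : nat).

Definition in_range (s : nat) (w : world) : Prop :=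
  wlev w <= s /\ wpos w <= l /\ wpos' w <= l /\ wbit w <= 1 /\ wans w <= 1.

(* The outcome of [t] is independent of the secrets where it is defined, or it is defined
   only if position [i] is the right one at level [c], for some [(c, i)] in [T]. *)
Definition uninformed (s : nat) (T : nat -> nat -> Prop) (q : nat) (t : world -> tm) : Prop :=
  (exists n, forall w v, in_range s w -> wans w = 0 -> val q (t w) v -> v = n) \/
  (exists c i, T c i /\
     forall w v, in_range s w -> wans w = 0 -> val q (t w) v -> pos w c = i).

Definition total (s q : nat) (t : world -> tm) : Prop :=
  forall w, in_range s w -> exists v, val q (t w) v.

(** The second half hides the answer: a family defined in all worlds cannot depend on it. The first
    half looks only at worlds with answer [0], where a test call, which returns the answer, has a
    constant outcome. *)
Definition good (s : nat) (T : nat -> nat -> Prop) (q : nat) (t : world -> tm) : Prop :=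
  uninformed s T q t /\
  (total s q t -> exists n, forall w, in_range s w -> val q (t w) n).

Lemma in_range_const (s a : nat) : a <= l -> in_range s (World 0 a a 0 0).
Proof. unfold in_range; simpl; lia. Qed.

(** Both halves survive when a family becomes less defined: if the less defined one is total, so is
    the other, and by determinism their outcomes agree. *)
Lemma good_sub (s : nat) (T T' : nat -> nat -> Prop) (q q' : nat) (t t' : world -> tm) :
  (forall c i, T c i -> T' c i) ->
  (forall w v, val q' (t' w) v -> val q (t w) v) ->
  good s T q t -> good s T' q' t'.
Proof.
  intros HT Hv [HR HP]. split.
  - destruct HR as [[n H]|(c & i & Hc & H)].
    + left. exists n. eauto.
    + right. exists c, i. eauto.
  - intros Htot. destruct HP as [n Hn].
    + intros w Hw. destruct (Htot w Hw) as [v H]. eauto.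
    + exists n. intros w Hw. destruct (Htot w Hw) as [v H].
      now rewrite (val_det _ _ _ _ _ (Hn w Hw) (Hv _ _ H)).
Qed.

Lemma good_0 (s : nat) (T : nat -> nat -> Prop) (t : world -> tm) : good s T 0 t.
Proof.
  split.
  - left. exists 0. intros w v _ _ H. now apply val_0 in H.
  - intros H. destruct (H _ (in_range_const s 0 (Nat.le_0_l _))) as [v Hv].
    now apply val_0 in Hv.
Qed.

Lemma good_Num (s : nat) (T : nat -> nat -> Prop) (q n : nat) : good s T q (fun _ => Num n).
Proof.
  split.
  - left. exists n. intros w v _ _. apply val_Num.
  - intros H. exists n. intros w Hw. destruct (H w Hw) as [v Hv].
    rewrite (val_Num _ _ _ Hv) in Hv. exact Hv.
Qed.

Lemma good_map (s : nat) (T : nat -> nat -> Prop) (q : nat) (f : nat -> nat)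
  (t t' : world -> tm) :
  (forall w v, val q (t' w) v -> exists m, val q (t w) m /\ v = f m) ->
  good s T q t -> good s T q t'.
Proof.
  intros Hf [HR HP]. split.
  - destruct HR as [[n H]|(c & i & Hc & H)].
    + left. exists (f n). intros w v Hw Ha Hv. destruct (Hf _ _ Hv) as (m & Hm & ->).
      f_equal. eauto.
    + right. exists c, i. split; auto. intros w v Hw Ha Hv.
      destruct (Hf _ _ Hv) as (m & Hm & ->). eauto.
  - intros Htot. destruct HP as [n Hn].
    + intros w Hw. destruct (Htot w Hw) as [v H]. destruct (Hf _ _ H) as (m & Hm & _). eauto.
    + exists (f n). intros w Hw. destruct (Htot w Hw) as [v H].
      destruct (Hf _ _ H) as (m & Hm & ->).
      now rewrite (val_det _ _ _ _ _ (Hn w Hw) Hm).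
Qed.

(** If the outcome of the condition is fixed, all worlds take the same branch; if the condition
    reveals a position, so does the conditional. When the conditional is total, so is the condition,
    and its constant value selects one total branch. *)
Lemma good_ifz (s : nat) (T : nat -> nat -> Prop) (q : nat) (a b c : world -> tm) :
  good s T q a -> good s T q b -> good s T q c ->
  good s T q (fun w => ifz (a w) (b w) (c w)).
Proof.
  intros [aR aP] [bR bP] [cR cP]. split.
  - destruct aR as [[n H]|(j & i & Hc & H)].
    + assert (K : forall w v, in_range s w -> wans w = 0 -> val q (ifz (a w) (b w) (c w)) v ->
                val q (match n with 0 => b w | S _ => c w end) v).
      { intros w v Hw Ha Hv. destruct (val_ifz _ _ _ _ _ Hv) as (m & Hm & K).
        now rewrite (H w m Hw Ha Hm) in K. }
      destruct n.
      * destruct bR as [[n' H']|(j & i & Hc & H')]; [left; exists n'|right; exists j, i]; eauto.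
      * destruct cR as [[n' H']|(j & i & Hc & H')]; [left; exists n'|right; exists j, i]; eauto.
    + right. exists j, i. split; auto. intros w v Hw Ha Hv.
      destruct (val_ifz _ _ _ _ _ Hv) as (m & Hm & _). eauto.
  - intros Htot. destruct aP as [n Hn].
    + intros w Hw. destruct (Htot w Hw) as [v H].
      destruct (val_ifz _ _ _ _ _ H) as (m & Hm & _). eauto.
    + assert (K : forall w v, in_range s w -> val q (ifz (a w) (b w) (c w)) v ->
                val q (match n with 0 => b w | S _ => c w end) v).
      { intros w v Hw Hv. destruct (val_ifz _ _ _ _ _ Hv) as (m & Hm & K).
        now rewrite (val_det _ _ _ _ _ Hm (Hn w Hw)) in K. }
      assert (C : exists n', forall w, in_range s w ->
                val q (match n with 0 => b w | S _ => c w end) n').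
      { destruct n.
        - apply bP. intros w Hw. destruct (Htot w Hw) as [v H]. eauto.
        - apply cP. intros w Hw. destruct (Htot w Hw) as [v H]. eauto. }
      destruct C as [n' Hn']. exists n'. intros w Hw. destruct (Htot w Hw) as [v H].
      now rewrite (val_det _ _ _ _ _ (Hn' w Hw) (K w v Hw H)).
Qed.

(** * The Kripke logical relation *)

(* [sT] is the set of pairs (level, position) about which terms may be informed. The levels
   in the gap [sc, sc + sg) are absent from [sT], and below the gap no level is fully
   present; later stages only add levels from [sc] upwards. *)
Record stage : Type := Stage
  { sT : nat -> nat -> Prop; sc : nat; sg : nat; sq : nat }.

Definition valid (a : stage) : Prop :=
  (forall b, b < sc a + sg a -> exists i, i <= l /\ ~ sT a b i) /\
  (forall b i, sc a <= b < sc a + sg a -> ~ sT a b i).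

(** The step bound decreases along the order, since a smaller bound only makes terms less defined
    and thus keeps them [good]. *)
Definition stage_le (a b : stage) : Prop :=
  (forall c i, sT a c i -> sT b c i) /\
  (forall c i, sT b c i -> sT a c i \/ sc a <= c) /\
  sc a <= sc b /\ sc b + sg b <= sc a + sg a /\ sq b <= sq a.

Lemma stage_le_refl (a : stage) : stage_le a a.
Proof. unfold stage_le. intuition. Qed.

Lemma stage_le_trans (a b c : stage) : stage_le a b -> stage_le b c -> stage_le a c.
Proof.
  intros (H1 & H2 & H3 & H4 & H5) (K1 & K2 & K3 & K4 & K5).
  repeat split; try lia; auto.
  intros x i Hx. destruct (K2 _ _ Hx) as [Hy|]; [auto|right; lia].
Qed.

Definition Stages : Type := nat -> stage.

(** The unbounded gap absorbs any fixed number of nested calls, each of which spends part of it. *)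
Definition Valid (ka : Stages) : Prop :=
  (forall s, valid (ka s)) /\ (forall B, eventually (fun s => B <= sg (ka s))).

Definition Le (ka ka' : Stages) : Prop := forall s, stage_le (ka s) (ka' s).

Lemma Le_refl (ka : Stages) : Le ka ka.
Proof. intros s. apply stage_le_refl. Qed.

Lemma Le_trans (a b c : Stages) : Le a b -> Le b c -> Le a c.
Proof. intros H K s. eapply stage_le_trans; eauto. Qed.

(** Closedness is built in so that environments can be substituted without lifting. Arrows quantify
    over later stages because arguments may be informed about more positions. *)
Fixpoint Rel (A : ty) (ka : Stages) (t : fam) : Prop :=
  match A with
  | TN => (forall s w, closed (t s w)) /\
      eventually (fun s => good s (sT (ka s)) (sq (ka s)) (t s))
  | TArr B C => (forall s w, closed (t s w)) /\
      forall ka', Valid ka' -> Le ka ka' -> forall u, Rel B ka' u ->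
        Rel C ka' (fun s w => App (t s w) (u s w))
  end.

Lemma Rel_closed (A : ty) (ka : Stages) (t : fam) : Rel A ka t -> forall s w, closed (t s w).
Proof. destruct A; intros []; auto. Qed.

Lemma Rel_mono (A : ty) (ka ka' : Stages) (t : fam) : Le ka ka' -> Rel A ka t -> Rel A ka' t.
Proof.
  intros Hle. destruct A; intros [Hc H]; split; auto.
  - revert H. apply eventually_impl. intros s. destruct (Hle s) as (H1 & _ & _ & _ & H5).
    apply good_sub; auto. intros w v. now apply val_mono.
  - intros ka'' Hv Hle' u Hu. apply H; auto. eapply Le_trans; eauto.
Qed.

(** A term takes no fewer steps than its reduct, so its bounded outcomes are also outcomes of the
    reduct. *)
Lemma Rel_expand (A : ty) : forall (ka : Stages) (t t' : fam),
  (forall s w, closed (t s w)) ->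
  (forall s w, clos_refl_trans tm step (t s w) (t' s w)) ->
  Rel A ka t' -> Rel A ka t.
Proof.
  induction A; intros ka t t' Hc Hs [_ H]; split; auto.
  - revert H. apply eventually_impl. intros s. apply good_sub; auto.
    intros w v. now apply val_star.
  - intros ka' Hv Hle u Hu. eapply IHA2; [| |apply H; eauto].
    + intros s w. simpl. split; auto. eapply Rel_closed; eauto.
    + intros s w. now apply star_App_l.
Qed.

Lemma inst_closed (A : ty) (ka : Stages) (zs : list fam) (s : nat) (w : world) :
  Forall (Rel A ka) zs -> Forall closed (inst s w zs).
Proof.
  intros H. unfold inst. apply Forall_map. revert H. apply Forall_impl.
  intros z Hz. eapply Rel_closed; eauto.
Qed.

Lemma Rel_narr_intro (m : nat) : forall (ka : Stages) (t : fam), Valid ka ->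
  (forall s w, closed (t s w)) ->
  (forall ka', Valid ka' -> Le ka ka' -> forall zs, length zs = m ->
     Forall (Rel TN ka') zs -> Rel TN ka' (fun s w => apps (t s w) (inst s w zs))) ->
  Rel (narr m) ka t.
Proof.
  induction m; intros ka t Hv Hc H.
  - apply (H ka Hv (Le_refl _) []); auto.
  - split; auto. intros ka' Hv' Hle u Hu. apply IHm; auto.
    + intros s w. simpl. split; auto. now apply (Rel_closed TN ka').
    + intros ka'' Hv'' Hle' zs Hz Hzs. apply (H ka'' Hv'' (Le_trans _ _ _ Hle Hle') (u :: zs)).
      * simpl. now rewrite Hz.
      * constructor; auto. now apply (Rel_mono TN ka').
Qed.

Lemma Rel_narr_elim (zs : list fam) : forall (ka : Stages) (t : fam), Valid ka ->
  Rel (narr (length zs)) ka t -> Forall (Rel TN ka) zs ->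
  Rel TN ka (fun s w => apps (t s w) (inst s w zs)).
Proof.
  induction zs as [|z zs IH]; intros ka t Hv Ht Hzs; simpl in Ht.
  - exact Ht.
  - inversion Hzs; subst. destruct Ht as [_ Ht].
    apply (IH ka (fun s w => App (t s w) (z s w))); auto. apply Ht; auto. apply Le_refl.
Qed.

(** * Fixed points at first-order types of small arity *)

Definition union (T : nat -> nat -> Prop) (ps : list (nat * nat)) (c i : nat) : Prop :=
  T c i \/ In (c, i) ps.

(* New arguments may be informed about any level of the gap, but only about [l] positions. *)
Definition good_fun (m s : nat) (a : stage) (q : nat) (h : world -> tm) : Prop :=
  (forall w, closed (h w)) /\
  forall ps, length ps <= l -> (forall c i, In (c, i) ps -> sT a c i \/ sc a <= c) ->
  forall zs : list (world -> tm), length zs = m ->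
    Forall (fun z => (forall w, closed (z w)) /\ good s (union (sT a) ps) q z) zs ->
    good s (union (sT a) ps) q (fun w => apps (h w) (map (fun z => z w) zs)).

(** Each listed level splits the gap at most once; keeping the larger part loses about half of it,
    hence the power of [2]. *)
Lemma avoid_levels (ps : list (nat * nat)) : forall c g, exists c' g',
  c <= c' /\ c' + g' <= c + g /\
  (forall b i, In (b, i) ps -> ~ c' <= b < c' + g') /\ g < 2 ^ length ps * S g'.
Proof.
  induction ps as [|[b i] ps IH]; intros c g.
  - exists c, g. simpl. repeat split; try lia.
  - destruct (IH c g) as (c1 & g1 & H1 & H2 & H3 & H4).
    assert (E : exists c' g', c1 <= c' /\ c' + g' <= c1 + g1 /\
              ~ c' <= b < c' + g' /\ g1 <= 2 * g' + 1).
    { destruct (le_lt_dec (c1 + g1) b); [exists c1, g1; lia|].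
      destruct (le_lt_dec c1 b); [|exists c1, g1; lia].
      destruct (le_lt_dec (2 * (b - c1) + 1) g1).
      - exists (S b), (c1 + g1 - S b). lia.
      - exists c1, (b - c1). lia. }
    destruct E as (c' & g' & K1 & K2 & K3 & K4). exists c', g'.
    repeat split; try lia.
    + intros b' i' [[= <- <-]|Hin]; auto. intros Hb. apply (H3 _ _ Hin). lia.
    + simpl length. rewrite Nat.pow_succ_r'. nia.
Qed.

(** Induction on the step bound: unfolding [Y] consumes a step, so the recursive occurrence is
    needed at smaller bounds only. *)
Lemma good_fun_Y (m s : nat) (a : stage) (body : world -> tm) :
  (forall w, closed (body w)) ->
  (forall q h, q <= sq a -> (forall q', q' <= q -> good_fun m s a q' h) ->
     good_fun m s a q (fun w => App (body w) (h w))) ->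
  forall q, q <= sq a -> good_fun m s a q (fun w => App (Yc (narr m)) (body w)).
Proof.
  intros Hc Hb q. induction q as [q IH] using lt_wf_ind. intros Hq.
  split; [simpl; auto|]. intros ps Hps Hps' zs Hzs Hz.
  destruct q as [|q]; [apply good_0|].
  destruct (Hb q (fun w => App (Yc (narr m)) (body w))) as [_ K];
    [lia|intros q' Hq'; apply IH; lia|].
  eapply good_sub; [| |apply (K ps Hps Hps' zs Hzs)]; auto.
  - intros w v. cbv beta. rewrite val_step; [eauto|]. apply step_apps. constructor.
  - revert Hz. apply Forall_impl. intros z [Hz Hg]. split; auto.
    eapply good_sub; [| |exact Hg]; auto. intros w v. apply val_mono. lia.
Qed.

Lemma map_nth_seq {A : Type} (d : A) (xs : list A) :
  map (fun i => nth i xs d) (seq 0 (length xs)) = xs.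
Proof.
  induction xs; simpl; auto. f_equal. rewrite <- seq_shift, map_map. exact IHxs.
Qed.

(** Each argument owes its information to at most one pair. This is where a function of few
    arguments loses information. *)
Lemma informing_pairs (s q : nat) (T T' : nat -> nat -> Prop) (zs : list (world -> tm)) :
  Forall (fun z => (forall w, closed (z w)) /\ good s T' q z) zs ->
  exists ps, length ps <= length zs /\ (forall c i, In (c, i) ps -> T' c i) /\
    Forall (fun z => (forall w, closed (z w)) /\ good s (union T ps) q z) zs.
Proof.
  induction 1 as [|z zs [Hz [HR HP]] _ (ps & H1 & H2 & H3)].
  - exists []. simpl. intuition.
  - destruct HR as [HR|(c & i & Hc & HR)].
    + exists ps. simpl. repeat split; auto. constructor; auto. repeat split; auto. now left.
    + exists ((c, i) :: ps). simpl. repeat split; try lia.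
      * intros c' i' [[= <- <-]|]; auto.
      * constructor.
        -- repeat split; auto. right. exists c, i. split; auto. right. now left.
        -- revert H3. apply Forall_impl. intros z' [Hz' Hg]. split; auto.
           eapply good_sub; [| |exact Hg]; auto. unfold union. simpl. intuition.
Qed.

(** The arguments together use at most [l] pairs of the later stage, so knowledge at [b] can be
    replaced by knowledge at [a] plus these pairs, which is what [good_fun] accepts. *)
Lemma good_fun_apply (s : nat) (a b : stage) (h : world -> tm) (zs : list (world -> tm)) :
  length zs <= l -> stage_le a b -> good_fun (length zs) s a (sq b) h ->
  Forall (fun z => (forall w, closed (z w)) /\ good s (sT b) (sq b) z) zs ->
  good s (sT b) (sq b) (fun w => apps (h w) (map (fun z => z w) zs)).
Proof.
  intros Hl' (L1 & L2 & _) [_ Hh] Hz.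
  destruct (informing_pairs s (sq b) (sT a) _ _ Hz) as (ps & H1 & H2 & H3).
  eapply good_sub; [| |apply (Hh ps); [lia| |reflexivity|exact H3]]; auto.
  intros c i [|]; auto.
Qed.

(* If the conclusion failed for infinitely many [s], then the counterexamples at these [s]
   would form a family contradicting the hypothesis: the at most [l] pairs about which their
   arguments are informed do not fill a level, and a large gap remains. *)
Lemma good_fun_eventually (m : nat) (ka : Stages) (body : fam) :
  Valid ka -> m <= l -> Rel (TArr (narr m) (narr m)) ka body ->
  eventually (fun s => forall q h, q <= sq (ka s) ->
    (forall q', q' <= q -> good_fun m s (ka s) q' h) ->
    good_fun m s (ka s) q (fun w => App (body s w) (h w))).
Proof.
  intros Hv Hm [Hc Hb]. apply NNPP. intros Hn.
  set (Claim := fun s => forall q h, q <= sq (ka s) ->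
    (forall q', q' <= q -> good_fun m s (ka s) q' h) ->
    good_fun m s (ka s) q (fun w => App (body s w) (h w))) in Hn.
  assert (D : forall s, exists d : (world -> tm) * (nat -> world -> tm) * stage,
    let '(h, z, a) := d in
    stage_le (ka s) a /\ valid a /\ sg (ka s) < 2 ^ l * S (sg a) /\
    (forall q', q' <= sq a -> good_fun m s (ka s) q' h) /\
    (forall i, i < m -> (forall w, closed (z i w)) /\ good s (sT a) (sq a) (z i)) /\
    (~ Claim s -> ~ good s (sT a) (sq a)
       (fun w => apps (App (body s w) (h w)) (map (fun i => z i w) (seq 0 m))))).
  { intros s. destruct (classic (Claim s)) as [HC|HC].
    (* Where the claim holds, a dummy stage with step bound [0] is used, at which everything is
       [good]. *)
    - exists (fun _ => Num 0, fun _ _ => Num 0, Stage (sT (ka s)) (sc (ka s)) (sg (ka s)) 0).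
      assert (1 <= 2 ^ l) by (apply Nat.neq_0_lt_0, Nat.pow_nonzero; lia).
      split; [|split; [|split; [|split; [|split]]]].
      + repeat split; simpl; auto; lia.
      + exact (proj1 Hv s).
      + simpl. nia.
      + simpl. intros q' Hq'. split; [simpl; auto|]. intros.
        replace q' with 0 by lia. apply good_0.
      + split; [simpl; auto|apply good_0].
      + intros HC'. contradiction.
    - destruct (not_all_ex_not _ _ HC) as [q HC1].
      destruct (not_all_ex_not _ _ HC1) as [h HC2].
      apply imply_to_and in HC2. destruct HC2 as [Hq HC2].
      apply imply_to_and in HC2. destruct HC2 as [Hh HC2].
      assert (E : exists ps zs, length ps <= l /\
        (forall c i, In (c, i) ps -> sT (ka s) c i \/ sc (ka s) <= c) /\ length zs = m /\
        Forall (fun z => (forall w, closed (z w)) /\ good s (union (sT (ka s)) ps) q z) zs /\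
        ~ good s (union (sT (ka s)) ps) q
            (fun w => apps (App (body s w) (h w)) (map (fun z => z w) zs))).
      { apply NNPP. intros HE. apply HC2. split.
        - intros w. simpl. split; auto. apply (proj1 (Hh q (le_n _))).
        - intros ps H1 H2 zs H3 H4. apply NNPP. intros H5. apply HE. eauto 10. }
      destruct E as (ps & zs & H1 & H2 & H3 & H4 & H5).
      (* Taking the levels of the new pairs out of the gap keeps the stage valid, at the cost of a
         factor of at most [2 ^ l]. *)
      destruct (avoid_levels ps (sc (ka s)) (sg (ka s))) as (c' & g' & G1 & G2 & G3 & G4).
      exists (h, fun i => nth i zs (fun _ => Num 0), Stage (union (sT (ka s)) ps) c' g' q).
      destruct (proj1 Hv s) as [V1 V2].
      split; [|split; [|split; [|split; [|split]]]]; simpl; auto.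
      + repeat split; simpl; auto; unfold union; auto.
        intros c i [|]; auto.
      + split; simpl.
        * intros b Hb'. destruct (le_lt_dec (sc (ka s)) b) as [Hcb|Hcb].
          (* A full level inside the old gap would need [l + 1] pairs from a list of at most [l]. *)
          -- apply NNPP. intros Hfull.
             assert (Hin : forall i, i <= l -> In (b, i) ps).
             { intros i Hi. apply NNPP. intros Hi'. apply Hfull. exists i. split; auto.
               intros [Ht|]; auto. apply (V2 b i); auto. lia. }
             assert (Hlen : length (map (pair b) (seq 0 (S l))) <= length ps).
             { apply NoDup_incl_length.
               - apply NoDup_map_NoDup_ForallPairs; [|apply seq_NoDup]. intros x y _ _ [=]; auto.
               - intros p Hp. apply in_map_iff in Hp. destruct Hp as (i & <- & Hi).
                 apply in_seq in Hi. apply Hin. lia. }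
             rewrite length_map, length_seq in Hlen. lia.
          -- destruct (V1 b) as (i & Hi & Hti); [lia|]. exists i. split; auto.
             intros [|Hin]; auto. destruct (H2 _ _ Hin); [auto|lia].
        * intros b i Hb' [Ht|Hin].
          -- apply (V2 b i); auto. lia.
          -- apply (G3 _ _ Hin). lia.
      + eapply Nat.lt_le_trans; [exact G4|]. apply Nat.mul_le_mono_r.
        apply Nat.pow_le_mono_r; lia.
      + intros i Hi. rewrite Forall_forall in H4. apply H4. apply nth_In. lia.
      + intros _ Hg. apply H5. eapply good_sub; [| |exact Hg]; auto.
        intros w v. cbv beta. rewrite <- H3, <- (map_nth_seq (fun _ => Num 0) zs) at 1.
        rewrite map_map. auto. }
  destruct (functional_choice _ D) as [d Hd].
  set (h := fun s w => fst (fst (d s)) w).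
  set (z := fun i s w => snd (fst (d s)) i w).
  set (ka' := fun s => snd (d s)).
  assert (Hd' : forall s, stage_le (ka s) (ka' s) /\ valid (ka' s) /\
    sg (ka s) < 2 ^ l * S (sg (ka' s)) /\
    (forall q', q' <= sq (ka' s) -> good_fun m s (ka s) q' (h s)) /\
    (forall i, i < m -> (forall w, closed (z i s w)) /\
       good s (sT (ka' s)) (sq (ka' s)) (z i s)) /\
    (~ Claim s -> ~ good s (sT (ka' s)) (sq (ka' s))
       (fun w => apps (App (body s w) (h s w)) (map (fun i => z i s w) (seq 0 m))))).
  { intros s. generalize (Hd s). unfold h, z, ka'. destruct (d s) as [[h0 z0] a0]. auto. }
  assert (Hv' : Valid ka').
  { split; [intros s; apply Hd'|]. intros B.
    generalize (proj2 Hv (2 ^ l * B)). apply eventually_impl. intros s Hs.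
    destruct (Hd' s) as (_ & _ & H & _). nia. }
  assert (Hle : Le ka ka') by (intros s; apply Hd').
  (* [h] is controlled for at most [l] pairs beyond [ka]; [good_fun_apply] extracts such pairs from
     its arguments. *)
  assert (Hh : Rel (narr m) ka' h).
  { apply Rel_narr_intro; auto.
    - intros s w. apply (Hd' s) with (q' := 0). lia.
    - intros ka2 Hv2 Hle2 zs Hzs Hz. split.
      + intros s w. apply apps_closed_at.
        * apply (Hd' s) with (q' := 0). lia.
        * eapply inst_closed; eauto.
      + assert (Hz' : eventually (fun s => Forall (fun z => (forall w, closed (z s w)) /\
           good s (sT (ka2 s)) (sq (ka2 s)) (z s)) zs)).
        { apply eventually_Forall. revert Hz. apply Forall_impl.
          intros y [Hy Hy']. revert Hy'. apply eventually_impl. auto. }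
        revert Hz'. apply eventually_impl. intros s Hz'.
        eapply good_sub; [| |apply (good_fun_apply s (ka s) (ka2 s) (h s)
          (map (fun z : fam => z s) zs))]; auto.
        * intros w v. cbv beta. rewrite map_map. auto.
        * rewrite length_map. lia.
        * eapply Le_trans; eauto.
        * rewrite length_map, Hzs. apply (Hd' s). apply Hle2.
        * now apply Forall_map. }
  assert (Hz : Forall (Rel TN ka') (map z (seq 0 m))).
  { apply Forall_map, Forall_forall. intros i Hi. apply in_seq in Hi. split.
    - intros s w. apply (Hd' s). lia.
    - exists 0. intros s _. apply (Hd' s). lia. }
  assert (Hbz := Rel_narr_elim (map z (seq 0 m)) ka' (fun s w => App (body s w) (h s w)) Hv').
  rewrite length_map, length_seq in Hbz.
  (* Relatedness of the body makes the collected counterexamples [good] for large [s], so the claim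
     holds there. *)
  destruct (Hbz (Hb ka' Hv' Hle h Hh) Hz) as [_ Hg].
  apply Hn. revert Hg. apply eventually_impl. intros s Hg. apply NNPP. intros HC.
  apply (Hd' s) in HC. apply HC. eapply good_sub; [| |exact Hg]; auto.
  intros w v. cbv beta. unfold inst. rewrite map_map. auto.
Qed.

(** The recursive function is analysed at the stage where the body arrives, while its arguments come
    from a later stage; [good_fun_apply] bridges the two. *)
Lemma Rel_Y (m : nat) (ka : Stages) : Valid ka -> m <= l ->
  Rel (TArr (TArr (narr m) (narr m)) (narr m)) ka (fun _ _ => Yc (narr m)).
Proof.
  intros _ Hm. split; [simpl; auto|]. intros ka1 Hv1 _ body Hbody.
  assert (Hc := Rel_closed _ _ _ Hbody).
  apply Rel_narr_intro; auto; [simpl; auto|].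
  intros ka2 Hv2 Hle2 zs Hzs Hz. split.
  { intros s w. apply apps_closed_at; [simpl; auto|]. eapply inst_closed; eauto. }
  assert (Hz' : eventually (fun s => Forall (fun z => (forall w, closed (z s w)) /\
    good s (sT (ka2 s)) (sq (ka2 s)) (z s)) zs)).
  { apply eventually_Forall. revert Hz. apply Forall_impl.
    intros y [Hy Hy']. revert Hy'. apply eventually_impl. auto. }
  generalize (eventually_and _ _ Hz' (good_fun_eventually m ka1 body Hv1 Hm Hbody)).
  apply eventually_impl. intros s [Hz'' Hb].
  eapply good_sub; [| |apply (good_fun_apply s (ka1 s) (ka2 s)
    (fun w => App (Yc (narr m)) (body s w)) (map (fun z : fam => z s) zs))]; auto.
  - intros w v. cbv beta. rewrite map_map. auto.
  - rewrite length_map. lia.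
  - rewrite length_map, Hzs. apply good_fun_Y; auto. apply Hle2.
  - now apply Forall_map.
Qed.

(** * The fundamental lemma *)

Lemma first_order_narr (A : ty) : lv A <= 1 -> A = narr (arity A).
Proof.
  induction A as [|A1 _ A2 IH]; auto. cbn [lv arity narr]. intros H.
  destruct A1; cbn [lv] in H; [|lia]. f_equal. apply IH. lia.
Qed.

Lemma arity_width (A : ty) : arity A <= width A.
Proof. destruct A; cbn [arity width]; lia. Qed.

Lemma Rel_Num (ka : Stages) (n : nat) : Rel TN ka (fun _ _ => Num n).
Proof. split; [simpl; auto|]. exists 0. intros. apply good_Num. Qed.

Lemma Rel_unary (ka : Stages) (c : tm) (f : nat -> nat) :
  closed c ->
  (forall q t v, val q (App c t) v -> exists m, val q t m /\ v = f m) ->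
  Rel (TArr TN TN) ka (fun _ _ => c).
Proof.
  intros Hc Hf. split; auto. intros ka' _ _ u [Hu Hg]. split; [simpl; auto|].
  revert Hg. apply eventually_impl. intros s. apply (good_map _ _ _ f). auto.
Qed.

Lemma Rel_Ifz (ka : Stages) : Valid ka -> Rel (narr 3) ka (fun _ _ => Ifz).
Proof.
  intros Hv. apply Rel_narr_intro; [auto|simpl; auto|].
  intros ka' _ _ zs Hzs Hz. split.
  - intros s w. apply apps_closed_at; [simpl; auto|]. eapply inst_closed; eauto.
  - destruct zs as [|a [|b [|c [|]]]]; try discriminate.
    inversion Hz as [|? ? [_ Ha] Hz']; subst. inversion Hz' as [|? ? [_ Hb] Hz'']; subst.
    inversion Hz'' as [|? ? [_ Hc] _]; subst.
    generalize (eventually_and _ _ Ha (eventually_and _ _ Hb Hc)). apply eventually_impl.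
    intros s (H1 & H2 & H3). simpl. now apply good_ifz.
Qed.

(** Induction on typing; the restriction on fixed point types enters through [Rel_Y]. *)
Lemma fundamental (G : list ty) (M : tm) (A : ty) : has_type G M A -> Y_only (adm_1l l) M ->
  forall (ka : Stages) (ga : list fam), Valid ka -> Forall2 (fun B u => Rel B ka u) G ga ->
  Rel A ka (fun s w => psub 0 (inst s w ga) M).
Proof.
  induction 1; intros HY ka ga Hv Hga.
  - simpl in *.
    assert (E : exists u, nth_error ga n = Some u /\ Rel s ka u).
    { revert n H. induction Hga; intros [|n] Hn; simpl in *; try discriminate; eauto.
      injection Hn as <-. eauto. }
    destruct E as (u & Hu & HR). eapply Rel_expand; [| |exact HR].
    + intros s' w. rewrite Nat.sub_0_r. unfold inst. rewrite nth_error_map, Hu. simpl.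
      eapply Rel_closed; eauto.
    + intros s' w. rewrite Nat.sub_0_r. unfold inst. rewrite nth_error_map, Hu. simpl.
      apply rt_refl.
  - assert (Hcl : forall s w, Forall closed (inst s w ga)).
    { intros s' w. clear - Hga. unfold inst. induction Hga; simpl; constructor; auto.
      eapply Rel_closed; eauto. }
    assert (Hcl' : forall s' w, closed (psub 0 (inst s' w ga) (Lam s M))).
    { intros s' w. apply psub_closed_at; auto. simpl. unfold inst. rewrite length_map.
      rewrite <- (Forall2_length Hga). apply (has_type_closed_at (s :: G) M t H). }
    split; auto. intros ka' Hv' Hle u Hu.
    eapply Rel_expand; [| |apply (IHhas_type HY ka' (u :: ga))]; auto.
    + intros s' w. split; [apply Hcl'|]. eapply Rel_closed; eauto.
    + intros s' w. apply star_beta; auto. eapply Rel_closed; eauto.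
    + constructor; auto. revert Hga. apply Forall2_impl. intros. eapply Rel_mono; eauto.
  - destruct HY as [HY1 HY2].
    destruct (IHhas_type1 HY1 ka ga Hv Hga) as [_ K].
    exact (K ka Hv (Le_refl _) _ (IHhas_type2 HY2 ka ga Hv Hga)).
  - apply Rel_Num.
  - apply (Rel_unary ka Suc S); [simpl; auto|]. apply val_Suc.
  - apply (Rel_unary ka Pre pred); [simpl; auto|]. apply val_Pre.
  - now apply Rel_Ifz.
  - simpl in HY.
    assert (lv s <= 1) by (destruct HY as [|[]]; lia).
    assert (arity s <= l).
    { destruct HY as [HY|[_ HY]].
      - destruct s; cbn [lv arity] in *; lia.
      - generalize (arity_width s). lia. }
    rewrite (first_order_narr s) by auto. now apply Rel_Y.
  (* The value [0] outside the domain of [f] is never taken: an application with an outcome has its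
     argument in the domain. *)
  - apply (Rel_unary ka (Cf f) (fun n => match f n with Some m => m | None => 0 end));
      [simpl; auto|].
    intros q t v Hv'. destruct (val_Cf _ _ _ _ Hv') as (m & Hm & Hf).
    exists m. now rewrite Hf.
Qed.

End Relation.

(** * The test functionals *)

(** A lazy case distinction: besides [i] only the selected entry is evaluated, so divergent inputs
    at other positions do no harm. The final [Num 0] stands for indices out of range. *)
Fixpoint sel (f : nat -> nat) (m : nat) (i : tm) (ts : list tm) : tm :=
  match ts with
  | [] => Num 0
  | t :: ts' => ifz (App (Cf (fun n => Some (if f n =? m then 0 else 1))) i) t
                  (sel f (S m) i ts')
  end.

Lemma psub_sel (c : nat) (ga : list tm) (f : nat -> nat) (i : tm) (ts : list tm) : forall m,
  psub c ga (sel f m i ts) = sel f m (psub c ga i) (map (psub c ga) ts).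
Proof. induction ts; simpl; intros m; congruence. Qed.

Lemma has_type_sel (G : list ty) (f : nat -> nat) (i : tm) (ts : list tm) :
  has_type G i TN -> Forall (fun t => has_type G t TN) ts ->
  forall m, has_type G (sel f m i ts) TN.
Proof.
  intros Hi. induction 1; simpl; intros m; repeat (econstructor; eauto).
Qed.

Lemma val_sel (q : nat) (f : nat -> nat) (i : tm) (n v : nat) (ts : list tm) : forall m,
  val q i n -> m <= f n < m + length ts -> val q (sel f m i ts) v ->
  val q (nth (f n - m) ts (Num 0)) v.
Proof.
  induction ts as [|t ts IH]; simpl; intros m Hi Hm Hv; [lia|].
  destruct (val_ifz _ _ _ _ _ Hv) as (b & Hb & Hv').
  destruct (val_Cf _ _ _ _ Hb) as (n' & Hn' & [= Hb']).
  rewrite (val_det _ _ _ _ _ Hn' Hi) in Hb'.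
  destruct (Nat.eqb_spec (f n) m); subst b.
  - replace (f n - m) with 0 by lia. auto.
  - replace (f n - m) with (S (f n - S m)) by lia. apply IH; auto. lia.
Qed.

Lemma star_sel (f : nat -> nat) (i : tm) (n : nat) (ts : list tm) : reduces_to i n ->
  forall m, m <= f n < m + length ts ->
  clos_refl_trans tm step (sel f m i ts) (nth (f n - m) ts (Num 0)).
Proof.
  intros Hi. induction ts as [|t ts IH]; simpl; intros m Hm; [lia|].
  eapply rt_trans; [eapply star_ifz, star_Cf; [exact Hi|reflexivity]|].
  destruct (Nat.eqb_spec (f n) m).
  - replace (f n - m) with 0 by lia. apply rt_refl.
  - replace (f n - m) with (S (f n - S m)) by lia. apply IH. lia.
Qed.

Lemma psub_vars (c : nat) (vs ga : list tm) :
  map (fun m => psub c (vs ++ ga) (Var m)) (seq c (length vs)) = vs.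
Proof.
  transitivity (map (fun i => nth i vs (Num 0)) (seq 0 (length vs))); [|apply map_nth_seq].
  assert (Hseq : forall n a, seq (c + a) n = map (Nat.add c) (seq a n)).
  { induction n; simpl; intros a; auto. now rewrite <- IHn, Nat.add_succ_r. }
  replace (seq c (length vs)) with (seq (c + 0) (length vs)) by now rewrite Nat.add_0_r.
  rewrite Hseq, map_map. apply map_ext_in.
  intros i Hi. apply in_seq in Hi. simpl. destruct (Nat.ltb_spec (c + i) c); [lia|].
  replace (c + i - c) with i by lia. rewrite nth_error_app1 by lia.
  now rewrite (nth_error_nth' _ (Num 0)) by lia.
Qed.

Lemma psub_rev_vars (c n : nat) (us ga : list tm) : length us = n ->
  map (psub c (rev us ++ ga)) (map Var (rev (seq c n))) = us.
Proof.
  intros <-. rewrite map_map, map_rev, <- length_rev, psub_vars. apply rev_involutive.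
Qed.

(* The arguments passed on from level [n] to level [n - 1], given that [j] has value [n]. *)
Definition arg (w : world) (m : nat) (j : tm) : tm :=
  App (Cf (fun n => match n with
                    | 0 => None
                    | S n' => if pos w n' =? m then Some (key w n') else None
                    end)) j.

Definition args (l : nat) (w : world) (j : tm) : list tm :=
  map (fun m => arg w m j) (seq 0 (S l)).

(* The alternatives [Num 0] are never reached: the conditions are [0] or diverge. *)
Definition test_body (l k : nat) (w : world) (g j : tm) (ys : list tm) : tm :=
  ifz (ifz (App (Cf (fun n => if n <=? k then Some (key w n) else None)) j)
         (App (Cf (fun n => if n =? 0 then Some 0 else None)) (sel (pos w) 0 j ys))
         (App (Cf (fun n => if n =? 1 then Some 0 else None)) (sel (pos w) 0 j ys)))
    (ifz j (Num (wans w))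
       (ifz (App (Cf (fun n => if n =? wans w then Some 0 else None))
               (apps g (App Pre j :: args l w j)))
          (Num (wans w)) (Num 0)))
    (Num 0).

(** Under the binders, [Var (S (S l))] is the functional argument, [Var (S l)] the level, and
    [Var l] down to [Var 0] are the inputs in order. *)
Definition test (l k : nat) (w : world) : tm :=
  Lam (narr (S (S l)))
    (lams (S (S l))
       (test_body l k w (Var (S (S l))) (Var (S l)) (map Var (rev (seq 0 (S l)))))).

Lemma length_args (l : nat) (w : world) (j : tm) : length (args l w j) = S l.
Proof. unfold args. now rewrite length_map, length_seq. Qed.

Lemma nth_args (l : nat) (w : world) (j : tm) (m : nat) : m <= l ->
  nth m (args l w j) (Num 0) = arg w m j.
Proof.
  intros H. rewrite (nth_indep _ _ (arg w 0 j)) by (rewrite length_args; lia).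
  unfold args. rewrite (map_nth (fun m => arg w m j)), seq_nth by lia. reflexivity.
Qed.

Lemma args_closed (l : nat) (w : world) (j : tm) : closed j -> Forall closed (args l w j).
Proof. intros H. apply Forall_map, Forall_forall. simpl. auto. Qed.

Lemma psub_test_body (c : nat) (ga : list tm) (l k : nat) (w : world) (g j : tm) (ys : list tm) :
  psub c ga (test_body l k w g j ys) =
  test_body l k w (psub c ga g) (psub c ga j) (map (psub c ga) ys).
Proof.
  unfold test_body. cbn [psub]. rewrite !psub_sel, psub_apps.
  cbn [map psub]. unfold args. rewrite map_map. reflexivity.
Qed.

Lemma has_type_test_body (G : list ty) (l k : nat) (w : world) (g j : tm) (ys : list tm) :
  has_type G g (narr (S (S l))) -> has_type G j TN -> Forall (fun t => has_type G t TN) ys ->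
  has_type G (test_body l k w g j ys) TN.
Proof.
  intros Hg Hj Hys. assert (Hs := has_type_sel G (pos w) j ys Hj Hys 0).
  assert (Ha : has_type G (apps g (App Pre j :: args l w j)) TN).
  { apply has_type_apps.
    - cbn [length]. now rewrite length_args.
    - constructor; [repeat (econstructor; eauto)|].
      apply Forall_map, Forall_forall. intros m _. repeat (econstructor; eauto). }
  unfold test_body. repeat (first [eassumption | econstructor]).
Qed.

Lemma has_type_test (l k : nat) (w : world) :
  has_type [] (test l k w) (TArr (narr (S (S l))) (narr (S (S l)))).
Proof.
  constructor. apply has_type_lams. apply has_type_test_body.
  - constructor. rewrite nth_error_app2; rewrite repeat_length; [|lia].
    now rewrite Nat.sub_diag.
  - constructor. rewrite nth_error_app1 by (rewrite repeat_length; lia).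
    apply nth_error_repeat. lia.
  - apply Forall_map, Forall_forall. intros m Hm. apply in_rev, in_seq in Hm.
    constructor. rewrite nth_error_app1 by (rewrite repeat_length; lia).
    apply nth_error_repeat. lia.
Qed.

Lemma test_closed (l k : nat) (w : world) : closed (test l k w).
Proof. apply (has_type_closed_at [] _ _ (has_type_test l k w)). Qed.

Lemma star_test (l k : nat) (w : world) (g j : tm) (ys : list tm) :
  closed g -> closed j -> Forall closed ys -> length ys = S l ->
  clos_refl_trans tm step (apps (App (test l k w) g) (j :: ys)) (test_body l k w g j ys).
Proof.
  intros Hg Hj Hys Hlen.
  set (B := test_body l k w (Var (S (S l))) (Var (S l)) (map Var (rev (seq 0 (S l))))).
  (* The empty substitution brings the abstraction into the form required by [star_beta]. *)
  assert (Ht : test l k w = Lam (narr (S (S l))) (psub 1 [] (lams (S (S l)) B))).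
  { unfold test. f_equal. symmetry. apply (psub_id _ _ 1); [|lia].
    exact (test_closed l k w). }
  rewrite Ht. eapply rt_trans; [apply star_apps, star_beta; auto|].
  replace (S (S l)) with (length (j :: ys)) by (simpl; lia).
  eapply rt_trans; [apply star_apps_lams; auto|].
  unfold B. rewrite psub_test_body. change (rev (j :: ys)) with (rev ys ++ [j]).
  rewrite <- app_assoc.
  rewrite psub_rev_vars by auto. cbn [psub Nat.ltb Nat.leb]. rewrite !Nat.sub_0_r.
  assert (Hr : length (rev ys) = S l) by now rewrite length_rev.
  rewrite (nth_error_app2 _ _ (n := S (S l))), (nth_error_app2 _ _ (n := S l)) by lia.
  rewrite Hr.
  replace (S l - S l) with 0 by lia. replace (S (S l) - S l) with 1 by lia.
  apply rt_refl.
Qed.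

Lemma pos_le (l s : nat) (w : world) (n : nat) : in_range l s w -> pos w n <= l.
Proof. unfold in_range, pos. destruct (n =? wlev w); lia. Qed.

Lemma key_le (l s : nat) (w : world) (n : nat) : in_range l s w -> key w n <= 1.
Proof. unfold in_range, key. destruct (n =? wlev w); lia. Qed.

Lemma val_test_body (l k q : nat) (w : world) (g j : tm) (ys : list tm) (r : nat) :
  in_range l k w -> length ys = S l -> val q (test_body l k w g j ys) r ->
  exists n, val q j n /\ n <= k /\ r = wans w /\
    val q (nth (pos w n) ys (Num 0)) (key w n) /\
    (n = 0 \/ val q (apps g (App Pre j :: args l w j)) (wans w)).
Proof.
  intros Hw Hlen H. unfold test_body in H.
  destruct (val_ifz _ _ _ _ _ H) as (b & Hb & H1). clear H.
  destruct (val_ifz _ _ _ _ _ Hb) as (e & He & Hb'). clear Hb.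
  destruct (val_Cf _ _ _ _ He) as (n & Hn & Hk). clear He. exists n.
  destruct (Nat.leb_spec n k); [|discriminate]. injection Hk as Hk.
  assert (Hp := pos_le _ _ _ n Hw). assert (Hkey := key_le _ _ _ n Hw).
  (* Keys are [0] or [1], and each of the two branches accepts exactly the key that leads to it. *)
  assert (Hs : b = 0 /\ val q (sel (pos w) 0 j ys) (key w n)).
  { destruct e as [|e]; destruct (val_Cf _ _ _ _ Hb') as (x & Hx & E).
    - destruct (Nat.eqb_spec x 0); [|discriminate]. injection E as <-.
      replace (key w n) with 0 by lia. subst x. auto.
    - destruct (Nat.eqb_spec x 1); [|discriminate]. injection E as <-.
      replace (key w n) with 1 by lia. subst x. auto. }
  destruct Hs as [-> Hs].
  apply (val_sel q (pos w) j n) in Hs; auto; [|simpl; lia]. rewrite Nat.sub_0_r in Hs.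
  destruct (val_ifz _ _ _ _ _ H1) as (n' & Hn' & H2).
  rewrite (val_det _ _ _ _ _ Hn' Hn) in H2.
  destruct n as [|n].
  - apply val_Num in H2. auto 10.
  - destruct (val_ifz _ _ _ _ _ H2) as (x & Hx & H3).
    destruct (val_Cf _ _ _ _ Hx) as (y & Hy & E).
    destruct (Nat.eqb_spec y (wans w)); [|discriminate]. injection E as <-. subst y.
    apply val_Num in H3. auto 10.
Qed.

Lemma test_body_reduces (l k : nat) (w : world) (g j : tm) (ys : list tm) (n : nat) :
  in_range l k w -> length ys = S l -> n <= k -> reduces_to j n ->
  reduces_to (nth (pos w n) ys (Num 0)) (key w n) ->
  (n <> 0 -> reduces_to (apps g (App Pre j :: args l w j)) (wans w)) ->
  reduces_to (test_body l k w g j ys) (wans w).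
Proof.
  intros Hw Hlen Hn Hj Hy Hg. unfold test_body.
  assert (Hp := pos_le _ _ _ n Hw). assert (Hkey := key_le _ _ _ n Hw).
  assert (Hs : reduces_to (sel (pos w) 0 j ys) (key w n)).
  { eapply rt_trans; [apply (star_sel _ _ _ _ Hj); lia|]. now rewrite Nat.sub_0_r. }
  eapply rt_trans; [apply (star_ifz _ _ _ 0)|].
  - eapply rt_trans; [apply (star_ifz _ _ _ (key w n))|].
    + apply (star_Cf _ _ _ _ Hj). destruct (Nat.leb_spec n k); auto; lia.
    + destruct (key w n) as [|[|x]]; [..|lia]; apply (star_Cf _ _ _ _ Hs); reflexivity.
  - eapply rt_trans; [apply (star_ifz _ _ _ n Hj)|]. destruct n as [|n]; [apply rt_refl|].
    eapply rt_trans; [apply (star_ifz _ _ _ 0)|apply rt_refl].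
    eapply star_Cf; [apply Hg; lia|]. now rewrite Nat.eqb_refl.
Qed.

(* [g0] only has to be a fixed point of the test functional up to call-by-name copies
   of its arguments, which covers fixed points taken at a type of which [narr] is a retract. *)
Lemma fixpoint_reduces (l k : nat) (w : world) (g0 : tm) : closed g0 -> in_range l k w ->
  (forall us, Forall closed us -> length us = S (S l) ->
     exists us', Forall closed us' /\ length us' = S (S l) /\
       (forall i n, i <= S l -> reduces_to (nth i us (Num 0)) n ->
          reduces_to (nth i us' (Num 0)) n) /\
       clos_refl_trans tm step (apps g0 us) (apps (App (test l k w) g0) us')) ->
  forall n us, n <= k -> Forall closed us -> length us = S (S l) ->
    reduces_to (nth 0 us (Num 0)) n ->
    reduces_to (nth (S (pos w n)) us (Num 0)) (key w n) ->
    reduces_to (apps g0 us) (wans w).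
Proof.
  intros Hg Hw Hfix. induction n; intros us Hn Hus Hlen Hj Hy;
    destruct (Hfix us Hus Hlen) as ([|j ys] & Hus' & Hlen' & Hval & Hstar);
    try discriminate; injection Hlen' as Hlen'; inversion Hus'; subst;
    (eapply rt_trans; [exact Hstar|]); (eapply rt_trans; [apply star_test; auto|]);
    assert (Hj' := Hval 0 _ (Nat.le_0_l _) Hj).
  - apply (test_body_reduces l k w g0 j ys 0); auto; [|congruence].
    apply (Hval (S (pos w 0))); auto. generalize (pos_le _ _ _ 0 Hw). lia.
  - apply (test_body_reduces l k w g0 j ys (S n)); auto.
    + apply (Hval (S (pos w (S n)))); auto. generalize (pos_le _ _ _ (S n) Hw). lia.
    + intros _. apply IHn; try lia.
      * constructor; [simpl; auto|]. now apply args_closed.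
      * cbn [length]. now rewrite length_args.
      * apply (star_Pre j (S n)). exact Hj'.
      (* [arg] reads the current level [S n] and supplies the key of level [n]. *)
      * cbn [nth]. rewrite nth_args by (eapply pos_le; eauto).
        apply (star_Cf _ _ _ _ Hj'). now rewrite Nat.eqb_refl.
Qed.

(** * The test functionals in the logical relation *)

Section Test.

Context (l : nat) (Hl : 1 <= l).

(** An outcome reveals that position [m] is the right one at level [n], and totality fails because
    there are at least two positions. *)
Lemma good_arg (s : nat) (T : nat -> nat -> Prop) (q n m : nat) (j : world -> tm) :
  T n m -> (forall w v, in_range l s w -> val q (j w) v -> v = S n) ->
  good l s T q (fun w => arg w m (j w)).
Proof.
  intros HT Hj.
  assert (Hpos : forall w v, in_range l s w -> val q (arg w m (j w)) v -> pos w n = m).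
  { intros w v Hw Hv. destruct (val_Cf _ _ _ _ Hv) as (x & Hx & E).
    rewrite (Hj w x Hw Hx) in E. destruct (Nat.eqb_spec (pos w n) m); congruence. }
  split.
  - right. exists n, m. eauto.
  (* A position other than [m], within range by [1 <= l]; the constant world has it at every
     level. *)
  - intros Htot. exfalso. set (i := if m =? 0 then 1 else 0).
    assert (Hi : i <= l) by (unfold i; destruct (m =? 0); lia).
    destruct (Htot _ (in_range_const l s i Hi)) as [v Hv].
    assert (E := Hpos _ _ (in_range_const l s i Hi) Hv).
    unfold pos in E. simpl in E.
    assert (i = m) by (destruct (n =? 0); auto).
    unfold i in *. destruct (Nat.eqb_spec m 0); lia.
Qed.

(** The input at position [m] must yield the key in all worlds whose position at level [n] is [m].
    Varying the key excludes a fixed outcome, and varying the position at the other levels excludes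
    information about those; what remains is the pair of [n] and [m]. *)
Lemma level_full (s q n : nat) (T : nat -> nat -> Prop) (ys : list (world -> tm)) :
  n <= s -> length ys = S l -> Forall (uninformed l s T q) ys ->
  (forall w, in_range l s w ->
     val q (nth (pos w n) (map (fun y => y w) ys) (Num 0)) (key w n)) ->
  forall m, m <= l -> T n m.
Proof.
  intros Hn Hlen Hys Hval m Hm.
  assert (Hr : forall i b, i <= l -> b <= 1 -> in_range l s (World n m i b 0))
    by (unfold in_range; simpl; lia).
  assert (Hv : forall i b, i <= l -> b <= 1 ->
    val q (nth m ys (fun _ => Num 0) (World n m i b 0)) b).
  { intros i b Hi Hb. generalize (Hval _ (Hr i b Hi Hb)). unfold pos, key. simpl.
    rewrite Nat.eqb_refl.
    assert (E := map_nth (fun y : world -> tm => y (World n m i b 0)) ys (fun _ => Num 0) m).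
    cbv beta in E. now rewrite E. }
  rewrite Forall_forall in Hys.
  destruct (Hys (nth m ys (fun _ => Num 0))) as [[x Hx]|(c & i & HT & Hx)].
  - apply nth_In. lia.
  - assert (0 = x) by (apply (Hx (World n m 0 0 0)); auto using Nat.le_0_l).
    assert (1 = x) by (apply (Hx (World n m 0 1 0)); auto using Nat.le_0_l).
    lia.
  - set (i' := if i =? 0 then 1 else 0).
    assert (Hi' : i' <= l) by (unfold i'; destruct (i =? 0); lia).
    assert (E : pos (World n m i' 0 0) c = i)
      by (apply (Hx _ 0); auto using Nat.le_0_l).
    unfold pos in E. simpl in E. destruct (Nat.eqb_spec c n).
    + now subst.
    + unfold i' in E. destruct (Nat.eqb_spec i 0); lia.
Qed.

(* A call of the test functional never succeeds in all worlds: its keys are available only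
   at a full level, that is above the gap, and its functional argument, which then becomes
   informed about the next lower level, would have to return the secret answer. *)
Lemma Rel_test (ka : Stages) :
  Rel l (TArr (narr (S (S l))) (narr (S (S l)))) ka (fun s w => test l s w).
Proof.
  split; [intros; apply test_closed|]. intros ka1 Hv1 _ g Hg.
  assert (Hgc := Rel_closed _ _ _ _ Hg).
  apply Rel_narr_intro; auto.
  { intros s w. split; auto. apply test_closed. }
  intros ka2 Hv2 Hle2 zs Hzs Hz. destruct zs as [|j ys]; [discriminate|].
  injection Hzs as Hlen. inversion Hz as [|? ? [Hjc Hj] Hys]; subst.
  assert (Hzc : forall s w, Forall closed (inst s w (j :: ys)))
    by (intros; eapply inst_closed; eauto).
  split.
  { intros s w. apply apps_closed_at; auto. split; auto. apply test_closed. }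
  set (u := fun s w => apps (App (test l s w) (g s w)) (inst s w (j :: ys))).
  assert (HI : forall s w q r, in_range l s w -> val q (u s w) r ->
    exists n, val q (j s w) n /\ n <= s /\ r = wans w /\
      val q (nth (pos w n) (inst s w ys) (Num 0)) (key w n) /\
      (n = 0 \/ val q (apps (g s w) (App Pre (j s w) :: args l w (j s w))) (wans w))).
  { intros s w q r Hw Hr. apply val_test_body with (ys := inst s w ys); auto.
    - unfold inst. now rewrite length_map.
    - assert (H := Hzc s w). inversion H; subst.
      eapply val_star; [|exact Hr]. apply star_test; auto. unfold inst. now rewrite length_map. }
  set (E := fun s => good l s (sT (ka2 s)) (sq (ka2 s)) (j s) /\
    Forall (fun y : fam => uninformed l s (sT (ka2 s)) (sq (ka2 s)) (y s)) ys /\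
    1 <= sg (ka2 s)).
  assert (HE : eventually E).
  { apply eventually_and; auto. apply eventually_and; [|apply Hv2].
    apply eventually_Forall. revert Hys. apply Forall_impl. intros y [_ Hy].
    revert Hy. apply eventually_impl. intros s []; auto. }
  (* Where the call is total, the new stage makes the next lower level fully known; elsewhere the
     stage is kept. The boolean records the case. *)
  assert (D : forall s, exists d : stage * bool, let (a, b) := d in
    stage_le (ka2 s) a /\ valid l a /\ sg (ka2 s) <= S (sg a) /\ sq a = sq (ka2 s) /\
    (b = true -> good l s (sT a) (sq a) (fun w => App Pre (j s w)) /\
       forall m, m <= l -> good l s (sT a) (sq a) (fun w => arg w m (j s w))) /\
    (E s -> total l s (sq (ka2 s)) (u s) -> b = true /\
       forall w, in_range l s w -> val (sq (ka2 s))
         (apps (g s w) (App Pre (j s w) :: args l w (j s w))) (wans w))).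
  { intros s. destruct (classic (E s /\ total l s (sq (ka2 s)) (u s))) as [[Hs Ht]|Hs].
    - destruct Hs as ([HjR HjP] & HyR & Hg1). destruct (proj1 Hv2 s) as [V1 V2].
      destruct HjP as [n Hn].
      { intros w Hw. destruct (Ht w Hw) as [r Hr].
        destruct (HI _ _ _ _ Hw Hr) as (n & Hn & _). eauto. }
      assert (HI' : forall w, in_range l s w -> n <= s /\
        val (sq (ka2 s)) (nth (pos w n) (inst s w ys) (Num 0)) (key w n) /\
        (n = 0 \/ val (sq (ka2 s)) (apps (g s w) (App Pre (j s w) :: args l w (j s w)))
                   (wans w))).
      { intros w Hw. destruct (Ht w Hw) as [r Hr].
        destruct (HI _ _ _ _ Hw Hr) as (n' & Hn' & H1 & _ & H2 & H3).
        rewrite (val_det _ _ _ _ _ Hn' (Hn w Hw)) in *. auto. }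
      assert (Hfull : forall m, m <= l -> sT (ka2 s) n m).
      { apply (level_full s (sq (ka2 s)) n _ (map (fun y : fam => y s) ys)).
        - apply (HI' _ (in_range_const l s 0 (Nat.le_0_l _))).
        - now rewrite length_map.
        - now apply Forall_map.
        - intros w Hw. rewrite map_map. apply (HI' w Hw). }
      (* No level below the upper end of the gap is full, so the level of the call lies beyond
         it. *)
      assert (Hge : sc (ka2 s) + sg (ka2 s) <= n).
      { destruct (le_lt_dec (sc (ka2 s) + sg (ka2 s)) n) as [|Hlt]; auto.
        destruct (V1 n Hlt) as (i & Hi & Hni). exfalso. auto. }
      destruct n as [|n]; [lia|].
      (* Level [n], one below the call, may be the topmost of the gap, so the gap gives up one
         level. *)
      exists (Stage (fun c i => sT (ka2 s) c i \/ c = n) (sc (ka2 s)) (pred (sg (ka2 s)))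
                (sq (ka2 s)), true).
      split; [|split; [|split; [|split; [|split]]]]; cbn [sT sc sg sq].
      + repeat split; simpl; auto; try lia. intros c i [|]; auto. right. lia.
      + split; simpl.
        * intros b Hb. destruct (V1 b) as (i & Hi & Hni); [lia|]. exists i. split; auto.
          intros [|]; auto. lia.
        * intros b i Hb [HT|]; [|lia]. apply (V2 b i); auto. lia.
      + lia.
      + reflexivity.
      + intros _. split.
        * split.
          -- left. exists n. intros w v Hw _ Hv. destruct (val_Pre _ _ _ Hv) as (x & Hx & ->).
             now rewrite (val_det _ _ _ _ _ Hx (Hn w Hw)).
          -- intros Ht'. exists n. intros w Hw. destruct (Ht' w Hw) as [v Hv].
             destruct (val_Pre _ _ _ Hv) as (x & Hx & ->).
             now rewrite (val_det _ _ _ _ _ Hx (Hn w Hw)) in *.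
        * intros m Hm. apply (good_arg _ _ _ n); auto.
          intros w v Hw Hv. eapply val_det; eauto.
      + intros _ _. split; auto. intros w Hw.
        destruct (HI' w Hw) as (_ & _ & [|]); [discriminate|auto].
    - exists (ka2 s, false). split; [apply stage_le_refl|]. split; [apply Hv2|].
      repeat split; try lia; try discriminate; exfalso; auto. }
  destruct (functional_choice _ D) as [d Hd].
  set (ka3 := fun s => fst (d s)). set (b := fun s => snd (d s)).
  assert (Hd' : forall s,
    stage_le (ka2 s) (ka3 s) /\ valid l (ka3 s) /\ sg (ka2 s) <= S (sg (ka3 s)) /\
    sq (ka3 s) = sq (ka2 s) /\
    (b s = true -> good l s (sT (ka3 s)) (sq (ka3 s)) (fun w => App Pre (j s w)) /\
       forall m, m <= l -> good l s (sT (ka3 s)) (sq (ka3 s)) (fun w => arg w m (j s w))) /\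
    (E s -> total l s (sq (ka2 s)) (u s) -> b s = true /\
       forall w, in_range l s w -> val (sq (ka2 s))
         (apps (g s w) (App Pre (j s w) :: args l w (j s w))) (wans w))).
  { intros s. generalize (Hd s). unfold ka3, b. now destruct (d s). }
  clearbody ka3 b. clear d Hd D.
  assert (Hv3 : Valid l ka3).
  { split; [intros s; apply Hd'|]. intros B. generalize (proj2 Hv2 (S B)).
    apply eventually_impl. intros s Hs. destruct (Hd' s) as (_ & _ & H & _). lia. }
  (* Numerals replace the arguments at indices where totality was not established, so that the
     families are related as a whole. *)
  set (P := fun s w => if b s then App Pre (j s w) else Num 0).
  set (A := fun m s w => if b s then arg w m (j s w) else Num 0).
  assert (Hargs : Forall (Rel l TN ka3) (P :: map A (seq 0 (S l)))).
  { constructor; [|apply Forall_map, Forall_forall; intros m Hm; apply in_seq in Hm];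
      (split; [intros s w; unfold P, A; destruct (b s); simpl; auto|]);
      exists 0; intros s _; unfold P, A; destruct (b s) eqn:Hb; try apply good_Num;
      apply Hd'; auto; lia. }
  assert (Hg3 : Rel l (narr (length (P :: map A (seq 0 (S l))))) ka3 g).
  { cbn [length]. rewrite length_map, length_seq. eapply Rel_mono; [|exact Hg].
    eapply Le_trans; [exact Hle2|]. intros s. apply Hd'. }
  destruct (Rel_narr_elim l _ _ _ Hv3 Hg3 Hargs) as [_ Hgood].
  generalize (eventually_and _ _ HE Hgood). apply eventually_impl. intros s [Hs [_ HP]].
  fold (u s). split.
  - destruct Hs as [[[[n Hn]|(c & i & HT & Hc)] _] _].
    (* The outcome is the answer, which is [0] in the worlds considered here. *)
    + left. exists 0. intros w v Hw Ha Hv. destruct (HI _ _ _ _ Hw Hv) as (_ & _ & _ & -> & _).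
      auto.
    + right. exists c, i. split; auto. intros w v Hw Ha Hv.
      destruct (HI _ _ _ _ Hw Hv) as (x & Hx & _). eauto.
  (* A total call would make [g] return the secret answer in every world, against the constancy of
     total [good] families. *)
  - intros Htot. exfalso. destruct (Hd' s) as (_ & _ & _ & Hq & _ & Hb).
    destruct (Hb Hs Htot) as [Hbs Hval]. clear Hb.
    assert (Hinst : forall w, inst s w (P :: map A (seq 0 (S l))) =
                      App Pre (j s w) :: args l w (j s w)).
    { intros w. unfold inst, P, A, args. cbn [map]. rewrite map_map.
      now rewrite Hbs. }
    destruct HP as [n Hn].
    { intros w Hw. exists (wans w). rewrite Hinst, Hq. auto. }
    assert (W : forall a, a <= 1 -> n = a).
    { intros a Ha. assert (Hw : in_range l s (World 0 0 0 0 a)) by (unfold in_range; simpl; lia).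
      assert (Hn' := Hn _ Hw). rewrite Hinst, Hq in Hn'.
      apply (val_det _ _ _ _ _ Hn' (Hval _ Hw)). }
    assert (n = 0) by (apply W; lia). assert (n = 1) by (apply W; lia). lia.
Qed.

Lemma uniform_bound (B : nat) (P : nat -> nat -> Prop) :
  (forall x q q', q <= q' -> P x q -> P x q') ->
  (forall x, x <= B -> exists q, P x q) -> exists q, forall x, x <= B -> P x q.
Proof.
  intros Hm. induction B; intros H.
  - destruct (H 0 (le_n _)) as [q Hq]. exists q. intros x Hx. now replace x with 0 by lia.
  - destruct IHB as [q Hq]; [auto|]. destruct (H (S B) (le_n _)) as [q' Hq'].
    exists (Nat.max q q'). intros x Hx. destruct (Nat.eq_dec x (S B)) as [->|].
    + apply (Hm _ q'); auto. lia.
    + apply (Hm _ q); [lia|]. apply Hq. lia.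
Qed.

(** Only finitely many worlds are in range. The common bound becomes the step bound of the initial
    stage. *)
Lemma uniform_bound_worlds (s : nat) (P : world -> nat -> Prop) :
  (forall w q q', q <= q' -> P w q -> P w q') ->
  (forall w, in_range l s w -> exists q, P w q) ->
  exists q, forall w, in_range l s w -> P w q.
Proof.
  intros Hm H.
  assert (K : exists q, forall a, a <= s -> forall b, b <= l -> forall c, c <= l ->
    forall d, d <= 1 -> forall e, e <= 1 -> P (World a b c d e) q).
  { do 5 (apply uniform_bound; [eauto 10|intros ? ?]). apply H. unfold in_range; simpl; auto. }
  destruct K as [q K]. exists q. intros [a b c d e] (H1 & H2 & H3 & H4 & H5). auto.
Qed.

(** The fundamental lemma makes such a term [good]; being total, it would have the same outcome in
    worlds with different answers. *)
Lemma test_undefinable (N : tm) :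
  has_type (TArr (narr (S (S l))) (narr (S (S l))) :: repeat TN (S (S l))) N TN ->
  Y_only (adm_1l l) N ->
  ~ (forall s w, in_range l s w ->
       reduces_to (psub 0 (test l s w :: Num s :: args l w (Num (S s))) N) (wans w)).
Proof.
  intros HN HY H.
  assert (Hq : forall s, exists q, forall w, in_range l s w ->
    val q (psub 0 (test l s w :: Num s :: args l w (Num (S s))) N) (wans w)).
  { intros s. apply uniform_bound_worlds.
    - intros w q q'. apply val_mono.
    - intros w Hw. apply reduces_to_val. auto. }
  destruct (functional_choice _ Hq) as [q Hq']. clear Hq.
  (* Initially the top level [s] is fully known and everything below it is gap, of size [s]. *)
  set (ka := fun s => Stage (fun c _ => c = s) 0 s (q s)).
  assert (Hv : Valid l ka).
  { split.
    - intros s. split; simpl.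
      + intros b Hb. exists 0. lia.
      + intros b i Hb. lia.
    - intros B. exists B. auto. }
  set (ga := (fun s w => test l s w) :: (fun s _ => Num s) ::
             map (fun m s w => arg w m (Num (S s))) (seq 0 (S l))).
  assert (Hga : Forall2 (fun B u => Rel l B ka u)
    (TArr (narr (S (S l))) (narr (S (S l))) :: repeat TN (S (S l))) ga).
  { constructor; [apply Rel_test|]. constructor.
    - split; [simpl; auto|]. exists 0. intros s _. apply good_Num.
    - assert (Ha : Forall (Rel l TN ka) (map (fun m s w => arg w m (Num (S s))) (seq 0 (S l)))).
      { apply Forall_map, Forall_forall. intros m _. split; [simpl; auto|].
        exists 0. intros s _. apply (good_arg _ _ _ s); [reflexivity|].
        intros w v _. apply val_Num. }
      assert (Hrep : forall xs, Forall (Rel l TN ka) xs ->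
        Forall2 (fun B u => Rel l B ka u) (repeat TN (length xs)) xs).
      { induction 1; simpl; constructor; auto. }
      apply Hrep in Ha. now rewrite length_map, length_seq in Ha. }
  destruct (fundamental l _ _ _ HN HY ka ga Hv Hga) as [_ [s Hs]].
  specialize (Hs s (le_n _)). destruct Hs as [_ HP].
  assert (Hinst : forall w, inst s w ga = test l s w :: Num s :: args l w (Num (S s))).
  { intros w. unfold inst, ga, args. cbn [map]. now rewrite map_map. }
  assert (Hall : forall w, in_range l s w -> val (q s) (psub 0 (inst s w ga) N) (wans w)).
  { intros w Hw. rewrite Hinst. auto. }
  destruct HP as [n Hn].
  { intros w Hw. eauto. }
  assert (W : forall a, a <= 1 -> n = a).
  { intros a Ha. assert (Hw : in_range l s (World 0 0 0 0 a)) by (unfold in_range; simpl; lia).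
    apply (val_det _ _ _ _ _ (Hn _ Hw) (Hall _ Hw)). }
  assert (n = 0) by (apply W; lia). assert (n = 1) by (apply W; lia). lia.
Qed.

End Test.

(** * Undefinability *)

Lemma Y_only_apps (P : ty -> Prop) (us : list tm) : forall t,
  Y_only P t -> Forall (Y_only P) us -> Y_only P (apps t us).
Proof.
  induction us; simpl; intros t Ht H; auto. inversion H; subst. apply IHus; simpl; auto.
Qed.

Lemma Y_only_lams (P : ty -> Prop) (n : nat) (t : tm) : Y_only P t -> Y_only P (lams n t).
Proof. induction n; simpl; auto. Qed.

Lemma Y_only_sel (P : ty -> Prop) (f : nat -> nat) (i : tm) (ts : list tm) :
  Y_only P i -> Forall (Y_only P) ts -> forall m, Y_only P (sel f m i ts).
Proof. intros Hi. induction 1; simpl; auto. Qed.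

Lemma Y_only_vars (P : ty -> Prop) (ns : list nat) : Forall (Y_only P) (map Var ns).
Proof. apply Forall_map, Forall_forall. simpl. auto. Qed.

Lemma subst_apps (j : nat) (u : tm) (us : list tm) : forall t,
  Forall closed us -> subst j u (apps t us) = apps (subst j u t) us.
Proof.
  induction us as [|v us IH]; simpl; intros t H; auto. inversion H; subst.
  rewrite IH by auto. simpl. now rewrite (subst_closed_at v 0) by (auto; lia).
Qed.

Lemma psub_cons_vars (c : nat) (t : tm) (us : list tm) :
  map (psub c (t :: us)) (map Var (seq (S c) (length us))) = us.
Proof.
  transitivity (map (fun m => psub c (us ++ []) (Var m)) (seq c (length us)));
    [|apply psub_vars].
  rewrite <- seq_shift, !map_map, app_nil_r. apply map_ext_in. intros m Hm.
  apply in_seq in Hm. cbn [psub].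
  destruct (Nat.ltb_spec (S m) c); [lia|]. destruct (Nat.ltb_spec m c); [lia|].
  replace (S m - c) with (S (m - c)) by lia. reflexivity.
Qed.

Lemma vars_typed (G : list ty) (n a : nat) (G1 : list ty) : length G1 = a ->
  Forall (fun t => has_type (G1 ++ repeat TN n ++ G) t TN) (map Var (seq a n)).
Proof.
  intros <-. apply Forall_map, Forall_forall. intros m Hm. apply in_seq in Hm.
  constructor. rewrite nth_error_app2 by lia.
  rewrite nth_error_app1 by (rewrite repeat_length; lia). apply nth_error_repeat. lia.
Qed.

(** The start at level [s] imitates a call from level [S s], whose numeral [arg] decrements. *)
Definition inputs (l s : nat) (w : world) : list tm := Num s :: args l w (Num (S s)).

Lemma inputs_closed (l s : nat) (w : world) : Forall closed (inputs l s w).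
Proof. constructor; [simpl; auto|]. apply args_closed. simpl. auto. Qed.

Lemma length_inputs (l s : nat) (w : world) : length (inputs l s w) = S (S l).
Proof. unfold inputs. cbn [length]. now rewrite length_args. Qed.

Lemma inputs_typed (G : list ty) (l s : nat) (w : world) :
  Forall (fun t => has_type G t TN) (inputs l s w).
Proof.
  constructor; [constructor|]. apply Forall_map, Forall_forall. intros m _.
  repeat econstructor.
Qed.

Lemma inputs_reduce (l s : nat) (w : world) : in_range l s w ->
  reduces_to (nth 0 (inputs l s w) (Num 0)) s /\
  reduces_to (nth (S (pos w s)) (inputs l s w) (Num 0)) (key w s).
Proof.
  intros Hw. split; [apply rt_refl|]. unfold inputs. cbn [nth].
  rewrite nth_args by (eapply pos_le; eauto).
  apply (star_Cf _ (Num (S s)) (S s)); [apply rt_refl|]. now rewrite Nat.eqb_refl.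
Qed.

(** A denoting term, applied to variables for the functional and its inputs, would contradict
    [test_undefinable]: observational equivalence transfers to it the value computed by the genuine
    operator. *)
Lemma Y_narr_undefinable (l : nat) : 1 <= l ->
  ~ denotable (adm_1l l) (TArr (TArr (narr (S (S l))) (narr (S (S l)))) (narr (S (S l))))
      (Yc (narr (S (S l)))).
Proof.
  intros Hl (M & HM & HY & Hobs). set (rho := narr (S (S l))) in *.
  assert (HMc := has_type_closed_at _ _ _ HM). simpl in HMc.
  apply (test_undefinable l Hl (apps (App M (Var 0)) (map Var (seq 1 (S (S l)))))).
  - apply has_type_apps.
    + rewrite length_map, length_seq. econstructor; [apply has_type_nil_weaken; exact HM|].
      now constructor.
    + generalize (vars_typed [] (S (S l)) 1 [TArr rho rho] eq_refl). now rewrite app_nil_r.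
  - apply Y_only_apps; [simpl; auto|]. apply Y_only_vars.
  - intros s w Hw. fold (inputs l s w). rewrite psub_apps. simpl psub at 1.
    rewrite (psub_id _ M 0) by (auto; lia).
    assert (Ev := psub_cons_vars 0 (test l s w) (inputs l s w)).
    rewrite length_inputs in Ev. rewrite Ev. clear Ev.
    assert (Hu := inputs_closed l s w). assert (Htc := test_closed l s w).
    assert (HC : has_type [TArr (TArr rho rho) rho]
                   (apps (App (Var 0) (test l s w)) (inputs l s w)) TN).
    { apply has_type_apps; [|apply inputs_typed]. rewrite length_inputs.
      econstructor; [now constructor|]. apply has_type_nil_weaken, has_type_test. }
    generalize (proj2 (Hobs _ HC (wans w))).
    rewrite !subst_apps by auto. cbn [subst Nat.eqb].
    rewrite !(subst_closed_at (test l s w) 0) by (auto; lia). intros Himp. apply Himp.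
    destruct (inputs_reduce l s w Hw) as [H1 H2].
    apply (fixpoint_reduces l s w (App (Yc rho) (test l s w))) with (n := s);
      auto using length_inputs; [simpl; auto|].
    intros us Hus Hlen. exists us. repeat split; auto.
    apply rt_step, step_apps. constructor.
Qed.

(* [tuple us] and [back n] exhibit the type of functions of [n] numbers as a retract of
   [bar2]; [H] and [F] are given in the scope of the binders in front of them. *)
Definition tuple (us : list tm) : tm := Lam TN (sel (fun n => n) 0 (Var 0) us).

Definition back (n : nat) (H : tm) : tm := lams n (App H (tuple (map Var (rev (seq 1 n))))).

(** [F] conjugated by the retraction, so that [back n] maps its fixed point at [bar2] to one of [F],
    up to rereading arguments through [tuple]. *)
Definition lifted (n : nat) (F : tm) : tm :=
  Lam bar2 (Lam (TArr TN TN)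
    (apps (App F (back n (Var (S n)))) (map (fun m => App (Var 0) (Num m)) (seq 0 n)))).

Lemma has_type_tuple (G : list ty) (us : list tm) :
  Forall (fun t => has_type (TN :: G) t TN) us -> has_type G (tuple us) (TArr TN TN).
Proof. intros H. constructor. apply has_type_sel; auto. now constructor. Qed.

Lemma has_type_back (n : nat) (H : tm) (G : list ty) :
  has_type (repeat TN n ++ G) H bar2 -> has_type G (back n H) (narr n).
Proof.
  intros HH. apply has_type_lams. econstructor; [exact HH|]. apply has_type_tuple.
  rewrite map_rev. apply Forall_rev. exact (vars_typed G n 1 [TN] eq_refl).
Qed.

Lemma has_type_lifted (n : nat) (F : tm) (G : list ty) :
  has_type (TArr TN TN :: bar2 :: G) F (TArr (narr n) (narr n)) ->
  has_type G (lifted n F) (TArr bar2 bar2).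
Proof.
  intros HF. do 2 constructor. apply has_type_apps.
  - rewrite length_map, length_seq. econstructor; [exact HF|]. apply has_type_back.
    constructor. rewrite nth_error_app2; rewrite repeat_length; [|lia].
    now replace (S n - n) with 1 by lia.
  - apply Forall_map, Forall_forall. intros m _. repeat econstructor.
Qed.

Lemma Y_only_tuple (P : ty -> Prop) (us : list tm) :
  Forall (Y_only P) us -> Y_only P (tuple us).
Proof. intros H. apply Y_only_sel; simpl; auto. Qed.

Lemma Y_only_lifted (P : ty -> Prop) (n : nat) (F : tm) : Y_only P F -> Y_only P (lifted n F).
Proof.
  intros HF. simpl. apply Y_only_apps.
  - split; auto. apply Y_only_lams. split; [simpl; auto|]. apply Y_only_tuple, Y_only_vars.
  - apply Forall_map, Forall_forall. simpl. auto.
Qed.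

Lemma tuple_closed_at (c : nat) (us : list tm) :
  Forall (closed_at (S c)) us -> closed_at c (tuple us).
Proof.
  intros H. unfold tuple. simpl.
  assert (K : forall m, closed_at (S c) (sel (fun n => n) m (Var 0) us)); [|apply K].
  induction H; simpl; auto. intros m. repeat split; auto; lia.
Qed.

Lemma tuple_closed (us : list tm) : Forall closed us -> closed (tuple us).
Proof.
  intros H. apply tuple_closed_at. revert H. apply Forall_impl.
  intros t. apply closed_at_weaken. lia.
Qed.

Lemma back_closed_at (n : nat) (H : tm) (c : nat) :
  closed_at (n + c) H -> closed_at c (back n H).
Proof.
  intros HH. unfold back.
  assert (K : closed_at (n + c) (App H (tuple (map Var (rev (seq 1 n)))))).
  { split; auto. apply tuple_closed_at. apply Forall_map, Forall_forall. intros m Hm.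
    apply in_rev, in_seq in Hm. simpl. lia. }
  clear HH. revert c K. generalize (App H (tuple (map Var (rev (seq 1 n))))).
  induction n; simpl; intros t c K; auto. apply IHn. now rewrite Nat.add_succ_r.
Qed.

Lemma star_tuple (us : list tm) (i : nat) : Forall closed us -> i < length us ->
  clos_refl_trans tm step (App (tuple us) (Num i)) (nth i us (Num 0)).
Proof.
  intros Hus Hi. assert (Hc := tuple_closed us Hus). unfold tuple in *.
  rewrite <- (psub_id [] (sel _ _ _ _) 1 1) by (exact Hc || lia).
  eapply rt_trans; [apply star_beta; simpl; auto|]. rewrite psub_sel.
  eapply rt_trans; [apply (star_sel _ _ i); [apply rt_refl|rewrite length_map; lia]|].
  rewrite Nat.sub_0_r.
  replace (map (psub 0 [Num i]) us) with us; [apply rt_refl|].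
  rewrite <- map_id at 1. apply map_ext_in. intros u Hu. rewrite Forall_forall in Hus.
  symmetry. apply (psub_id _ _ 0); auto.
Qed.

Lemma star_back (H : tm) (us : list tm) : closed H -> Forall closed us ->
  clos_refl_trans tm step (apps (back (length us) H) us) (App H (tuple us)).
Proof.
  intros HH Hus.
  rewrite <- (psub_id [] (back _ H) 0 0); [|apply back_closed_at|lia].
  2: { apply (closed_at_weaken _ 0); auto. lia. }
  eapply rt_trans; [apply star_apps_lams; auto|]. cbn [psub].
  rewrite (psub_id _ H 0) by (auto; lia). unfold tuple. cbn [psub].
  rewrite psub_sel, psub_rev_vars by auto. apply rt_refl.
Qed.

Lemma psub_back (n : nat) (G H : tm) : psub 0 [G; H] (back n (Var (S n))) = back n H.
Proof.
  unfold back. rewrite psub_lams, Nat.add_0_r. f_equal. cbn [psub].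
  destruct (Nat.ltb_spec (S n) n); [lia|]. replace (S n - n) with 1 by lia. simpl nth_error.
  f_equal. apply (psub_id _ _ n); auto. apply tuple_closed_at, Forall_map, Forall_forall.
  intros m Hm. apply in_rev, in_seq in Hm. simpl. lia.
Qed.

Lemma star_lifted (n : nat) (F H G : tm) : closed F -> closed H -> closed G ->
  clos_refl_trans tm step (App (App (lifted n F) H) G)
    (apps (App F (back n H)) (map (fun m => App G (Num m)) (seq 0 n))).
Proof.
  intros HF HH HG.
  set (B := apps (App F (back n (Var (S n)))) (map (fun m => App (Var 0) (Num m)) (seq 0 n))).
  assert (E : lifted n F = Lam bar2 (psub 1 [] (Lam (TArr TN TN) B))).
  { unfold lifted. fold B. f_equal. symmetry. apply (psub_id _ _ 1); auto.
    simpl. apply apps_closed_at.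
    - split; [apply (closed_at_weaken _ 0); auto; lia|]. apply back_closed_at. simpl. lia.
    - apply Forall_map, Forall_forall. simpl. intros. split; auto; lia. }
  rewrite E. eapply rt_trans; [apply star_App_l, star_beta; auto|].
  cbn [psub]. eapply rt_trans; [apply star_beta; auto|].
  unfold B. rewrite psub_apps, map_map. cbn [psub]. rewrite psub_back.
  rewrite (psub_id _ F 0) by (auto; lia). apply rt_refl.
Qed.

Lemma Y_bar2_reduces (l s : nat) (w : world) : in_range l s w ->
  reduces_to (App (App (Yc bar2) (lifted (S (S l)) (test l s w))) (tuple (inputs l s w))) (wans w).
Proof.
  intros Hw. set (n := S (S l)). set (Yb := App (Yc bar2) (lifted n (test l s w))).
  assert (Hlc : closed (lifted n (test l s w))).
  { apply (has_type_closed_at [] _ (TArr bar2 bar2)), has_type_lifted.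
    apply has_type_nil_weaken, has_type_test. }
  assert (HYc : closed Yb) by (simpl; auto).
  assert (Hred : reduces_to (apps (back n Yb) (inputs l s w)) (wans w)).
  { destruct (inputs_reduce l s w Hw) as [H1 H2].
    apply (fixpoint_reduces l s w (back n Yb)) with (n := s);
      auto using inputs_closed, length_inputs.
    - apply back_closed_at. apply (closed_at_weaken _ 0); auto. lia.
    (* The call-by-name copies are the projections of the tuple of the arguments. *)
    - intros us Hus Hlen. exists (map (fun m => App (tuple us) (Num m)) (seq 0 n)).
      assert (Htc := tuple_closed us Hus). repeat split.
      + apply Forall_map, Forall_forall. simpl. auto.
      + now rewrite length_map, length_seq.
      + intros i v Hi Hv.
        rewrite (nth_indep _ _ (App (tuple us) (Num 0)))
          by (rewrite length_map, length_seq; unfold n; lia).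
        rewrite (map_nth (fun m => App (tuple us) (Num m))), seq_nth by (unfold n; lia).
        eapply rt_trans; [apply star_tuple; auto; simpl; lia|]. exact Hv.
      + unfold n. rewrite <- Hlen. eapply rt_trans; [apply star_back; auto|].
        rewrite Hlen. fold n. eapply rt_trans; [apply rt_step; do 2 constructor|].
        apply star_lifted; auto. apply test_closed. }
  (* The term in question is a reduct of the one just evaluated, so determinism passes the value
     on. *)
  apply reduces_to_val. apply reduces_to_val in Hred. destruct Hred as [q Hq]. exists q.
  eapply val_star; [|exact Hq]. unfold n. rewrite <- (length_inputs l s w).
  apply star_back; auto. apply inputs_closed.
Qed.

Lemma adm_1_bounded (M : tm) : Y_only adm_1 M ->
  exists l0, forall l, l0 <= l -> Y_only (adm_1l l) M.
Proof.
  induction M; simpl; intros H; try (exists 0; now auto).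
  - auto.
  - destruct H as [H1 H2]. destruct (IHM1 H1) as [a Ha], (IHM2 H2) as [b Hb].
    exists (Nat.max a b). intros l Hl. split; [apply Ha|apply Hb]; lia.
  - exists (width t). intros l Hl. unfold adm_1, adm_1l in *. lia.
Qed.

Lemma Y_bar2_undefinable : ~ denotable adm_1 (TArr (TArr bar2 bar2) bar2) (Yc bar2).
Proof.
  intros (M & HM & HY & Hobs). destruct (adm_1_bounded M HY) as [l0 Hl0].
  (* The successor ensures [1 <= l]. *)
  set (l := S l0). assert (HMY : Y_only (adm_1l l) M) by (apply Hl0; unfold l; lia).
  assert (Hl : 1 <= l) by (unfold l; lia). clearbody l. clear l0 Hl0 HY.
  assert (HMc := has_type_closed_at _ _ _ HM). simpl in HMc.
  set (n := S (S l)). set (rho := narr n).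
  (* [Var 2] reaches the functional past the two binders of [lifted]; under the binder of [tuple]
     the inputs start at index [2]. *)
  apply (test_undefinable l Hl
    (App (App M (lifted n (Var 2))) (tuple (map Var (seq 2 n))))).
  - econstructor; [econstructor|].
    + apply has_type_nil_weaken; exact HM.
    + apply has_type_lifted. now constructor.
    + apply has_type_tuple.
      generalize (vars_typed [] n 2 [TN; TArr rho rho] eq_refl). now rewrite app_nil_r.
  - split; [split; auto|].
    + now apply Y_only_lifted.
    + apply Y_only_tuple, Y_only_vars.
  - intros s w Hw. fold (inputs l s w).
    assert (Hu := inputs_closed l s w). assert (Htc := test_closed l s w).
    assert (Hlt : forall G, has_type G (lifted n (test l s w)) (TArr bar2 bar2)).
    { intros G. apply has_type_lifted, has_type_nil_weaken, has_type_test. }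
    assert (Hlc := has_type_closed_at [] _ _ (Hlt [])).
    assert (Htup := tuple_closed _ Hu).
    assert (E : psub 0 (test l s w :: inputs l s w)
                  (App (App M (lifted n (Var 2))) (tuple (map Var (seq 2 n)))) =
                App (App M (lifted n (test l s w))) (tuple (inputs l s w))).
    { cbn [psub]. rewrite (psub_id _ M 0) by (auto; lia). f_equal; [f_equal|].
      - unfold lifted. cbn [psub]. rewrite psub_apps, map_map. cbn [psub].
        rewrite (psub_id _ (back n (Var (S n))) 2); auto.
        apply back_closed_at. simpl. lia.
      - unfold tuple. cbn [psub]. rewrite psub_sel.
        assert (Ev := psub_cons_vars 1 (test l s w) (inputs l s w)).
        rewrite length_inputs in Ev. unfold n. now rewrite Ev. }
    rewrite E.
    assert (HC : has_type [TArr (TArr bar2 bar2) bar2]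
      (App (App (Var 0) (lifted n (test l s w))) (tuple (inputs l s w))) TN).
    { econstructor; [econstructor; [now constructor|apply Hlt]|].
      apply has_type_tuple, inputs_typed. }
    generalize (proj2 (Hobs _ HC (wans w))). cbn [subst Nat.eqb].
    rewrite !(subst_closed_at (lifted n (test l s w)) 0) by (auto; lia).
    rewrite !(subst_closed_at (tuple (inputs l s w)) 0) by (auto; lia).
    intros Himp. apply Himp. now apply Y_bar2_reduces.
Qed.

Theorem theorem6p12 :
  (forall l : nat, 1 <= l ->
     ~ denotable (adm_1l l) (TArr (TArr (narr (l + 2)) (narr (l + 2))) (narr (l + 2)))
         (Yc (narr (l + 2))))
  /\
  ~ denotable adm_1 (TArr (TArr bar2 bar2) bar2) (Yc bar2).
Proof.
  split; [|exact Y_bar2_undefinable].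
  intros l Hl. replace (l + 2) with (S (S l)) by lia. now apply Y_narr_undefinable.
Qed.
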